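(* There exist a connected complete Riemannian manifold $(M,g)$ of finite volume and bounded sectional curvature and a $C^1$ diffeomorphism $F\colon M\to M$ such that: (i) $F$ is Anosov with respect to $g$, with stable and unstable bundles $E^s$, $E^u$ that are orthogonal with respect to $g$ at every point; (ii) $F$ has the Lipschitz shadowing property with respect to the Riemannian distance $d_g$; (iii) $F$ is not expansive with respect to the Riemannian distance $d_g$.
   Context: Manifolds are finite-dimensional, of positive dimension. Bounded sectional curvature means that there is a constant $K$ with $|\sec_g|\leq K$ for all tangent 2-planes at all points. **Anosov.** A $C^1$ diffeomorphism $f\colon M\to M$ is Anosov with respect to a Riemannian metric (with induced norm $\|\cdot\|$) if there exist a continuous $Df$-invariant splitting $TM=E^s\oplus E^u$ and constants $C>0$, $\lambda\in(0,1)$ such that $$\|Df_x^n|_{E_x^s}\|\leq C\lambda^n,\qquad \|Df_x^{-n}|_{E_x^u}\|\leq C\lambda^n$$ for every $x\in M$ and every integer $n\geq 0$. The bundles $E^s$, $E^u$ are the stable and unstable (invariant) bundles. **Lipschitz shadowing.** With $d$ the Riemannian distance, a sequence $(x_n)_{n\in\mathbb Z}$ in $M$ is a $\delta$-pseudo-orbit of $f$ if $d(f(x_n),x_{n+1})\leq\delta$ for every $n\in\mathbb Z$. The map $f$ has the Lipschitz shadowing property if there are $L>0$ and $\delta_0>0$ such that for every $0<\delta<\delta_0$ and every $\delta$-pseudo-orbit $(x_n)_{n\in\mathbb Z}$ there is $z\in M$ with $d(f^n(z),x_n)\leq L\delta$ for every $n\in\mathbb Z$. **Expansive.** A homeomorphism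 $h\colon Y\to Y$ of a metric space $(Y,\rho)$ is expansive (with respect to $\rho$) if there exists $\epsilon>0$ such that, for all $x,y\in Y$, $\rho(h^n(x),h^n(y))\leq\epsilon$ for every $n\in\mathbb Z$ implies $x=y$. *)

(* Defs.v *)
From HB Require Import structures.
From mathcomp Require Import all_boot all_order all_algebra.
From mathcomp Require Import all_classical all_reals all_analysis.

Set Implicit Arguments.
Unset Strict Implicit.
Unset Printing Implicit Defensive.

Import Order.TTheory GRing.Theory Num.Theory.
Import numFieldNormedType.Exports.

Local Open Scope classical_set_scope.
Local Open Scope ring_scope.

Section Calculus.
Context {R : realType}.

(* Meaningful for U open: the partial derivatives only depend on f near the
   points of U. *)
Fixpoint Ck {m : nat} {V : normedModType R} (k : nat) (U : set 'rV[R]_m)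
    (f : 'rV[R]_m -> V) : Prop :=
  (forall p, U p -> {for p, continuous f}) /\
  if k is k'.+1 then
    forall i : 'I_m, (forall p, U p -> derivable f p (delta_mx 0 i)) /\
                     Ck k' U (fun p => 'D_(delta_mx 0 i) f p)
  else True.

Definition Coo {m : nat} {V : normedModType R} (U : set 'rV[R]_m)
  (f : 'rV[R]_m -> V) : Prop := forall k, Ck k U f.

(* By Tonelli, the m-dimensional Lebesgue integral when f is Borel and
   nonnegative, which is the only use made of it. *)
Fixpoint iterated_integral (m : nat) : ('rV[R]_m -> \bar R) -> \bar R :=
  match m return ('rV[R]_m -> \bar R) -> \bar R with
  | 0 => fun f => f 0
  | m'.+1 => fun f =>
      (\int[lebesgue_measure]_(t in [set: R])
         @iterated_integral m' (fun v => f (row_mx (const_mx t : 'rV_1) v)))%E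
  end.

End Calculus.

Record chart (R : realType) (n : nat) (M : topologicalType) := Chart {
  cdom : set M;
  cmap :> M -> 'rV[R]_n;
  cinv : 'rV[R]_n -> M;
  cdom_open : open cdom;
  cimg_open : open (cmap @` cdom);
  cmapK : forall x, cdom x -> cinv (cmap x) = x;
  cmap_continuous : forall x, cdom x -> {for x, continuous cmap};
  cinv_continuous : forall p, (cmap @` cdom) p -> {for p, continuous cinv}
}.

(* [chart_at] selects a chart around each point. The tangent space at x is
   R^mdim, a vector standing for its coordinates in the chart [chart_at x]. *)
Record manifold (R : realType) := Manifold {
  carrier :> topologicalType;
  mdim : nat;
  mdim_gt0 : (0 < mdim)%N;
  carrier_hausdorff : hausdorff_space carrier;
  carrier_second_countable : @second_countable carrier;
  atlas_index : Type;
  atlas : atlas_index -> chart R mdim carrier;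
  chart_at : carrier -> atlas_index;
  chart_atP : forall x, cdom (atlas (chart_at x)) x;
  atlas_smooth : forall i j,
    Coo (atlas i @` (cdom (atlas i) `&` cdom (atlas j)))
        (atlas j \o cinv (atlas i))
}.

(* [gram i p] is the matrix of the metric at the point of coordinates p in the
   chart i; only its values on the image of the chart matter. *)
Record riemannian_manifold (R : realType) := RiemannianManifold {
  base :> manifold R;
  gram : atlas_index base -> 'rV[R]_(mdim base) -> 'M[R]_(mdim base);
  gram_smooth : forall i, Coo (atlas i @` cdom (atlas i)) (gram i);
  gram_sym : forall i x, cdom (atlas i) x ->
    (gram i (atlas i x))^T = gram i (atlas i x);
  gram_pos : forall i x, cdom (atlas i) x -> forall v : 'rV[R]_(mdim base),
    v != 0 -> 0 < (v *m gram i (atlas i x) *m v^T) 0 0;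
  gram_change : forall i j x, cdom (atlas i) x -> cdom (atlas j) x ->
    forall u v : 'rV[R]_(mdim base),
    let D := 'd (atlas j \o cinv (atlas i)) (atlas i x) in
    u *m gram i (atlas i x) *m v^T = D u *m gram j (atlas j x) *m (D v)^T
}.

Section Maps.
Context {R : realType} {M : manifold R}.
Implicit Types (f : M -> M) (x : M).

Definition C1_map f : Prop := continuous f /\ forall i j : atlas_index M,
  Ck 1 (atlas i @` (cdom (atlas i) `&` f @^-1` cdom (atlas j)))
       (atlas j \o f \o cinv (atlas i)).

Definition tangent_map f x : 'rV[R]_(mdim M) -> 'rV[R]_(mdim M) :=
  'd (atlas (chart_at (f x)) \o f \o cinv (atlas (chart_at x)))
     (atlas (chart_at x) x).

(* Coordinates in the chart i of a tangent vector at x. *)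
Definition tangent_coord (i : atlas_index M) x
    : 'rV[R]_(mdim M) -> 'rV[R]_(mdim M) :=
  'd (atlas i \o cinv (atlas (chart_at x))) (atlas (chart_at x) x).

Definition continuous_field_at (X : M -> 'rV[R]_(mdim M)) x : Prop :=
  {for x, continuous (fun y => tangent_coord (chart_at x) y (X y))}.

Definition continuous_subbundle (E : M -> {vspace 'rV[R]_(mdim M)}) : Prop :=
  forall x0, exists (k : nat) (X : 'I_k -> M -> 'rV[R]_(mdim M)),
    \forall x \near x0,
      basis_of (E x) [seq X j x | j <- enum 'I_k] /\
      forall j, continuous_field_at (X j) x.

Definition C1_curve (c : R -> M) : Prop := continuous c /\
  forall (i : atlas_index M) t, cdom (atlas i) (c t) ->
    derivable (atlas i \o c) t 1 /\ {for t, continuous (derive1 (atlas i \o c))}.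

Definition velocity (c : R -> M) (t : R) : 'rV[R]_(mdim M) :=
  derive1 (atlas (chart_at (c t)) \o c) t.

End Maps.

Record C1_diffeo (R : realType) (M : manifold R) := C1Diffeo {
  diffeo_fun :> M -> M;
  diffeo_inv : M -> M;
  diffeo_funK : cancel diffeo_fun diffeo_inv;
  diffeo_invK : cancel diffeo_inv diffeo_fun;
  diffeo_fun_C1 : C1_map diffeo_fun;
  diffeo_inv_C1 : C1_map diffeo_inv
}.

Section Riemannian.
Context {R : realType} {M : riemannian_manifold R}.
Implicit Types (x y : M) (u v w : 'rV[R]_(mdim M)).

Definition metric x u v : R :=
  (u *m gram (chart_at x) (atlas (chart_at x) x) *m v^T) 0 0.

Definition tnorm x v : R := Num.sqrt (metric x v v).

Definition curve_length (c : R -> M) : \bar R :=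
  (\int[lebesgue_measure]_(t in `[0%R, 1%R]) (tnorm (c t) (velocity c t))%:E)%E.

(* [path_of_length x y l]: some piecewise C^1 path from x to y has length l.
   Each piece is parametrized by [0, 1]; asking it to be the restriction of a
   C^1 curve defined on R is no restriction. *)
Inductive path_of_length : M -> M -> \bar R -> Prop :=
| path_nil x : path_of_length x x 0%E
| path_cons (c : R -> M) y l : C1_curve c -> path_of_length (c 1) y l ->
    path_of_length (c 0) y (curve_length c + l)%E.

Definition rdist x y : \bar R := ereal_inf [set l | path_of_length x y l].

Definition complete_manifold : Prop := forall u : nat -> M,
  (forall e : R, 0 < e -> exists N, forall m n, (N <= m)%N -> (N <= n)%N ->
     (rdist (u m) (u n) < e%:E)%E) ->
  exists x, forall e : R, 0 < e -> exists N, forall n, (N <= n)%N ->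
     (rdist (u n) x < e%:E)%E.

Definition connected_manifold : Prop :=
  [set: M] !=set0 /\ connected [set: M].

(* Volume of a Borel set B contained in the domain of the chart i. *)
Definition chart_volume (i : atlas_index M) (B : set M) : \bar R :=
  iterated_integral (fun p =>
    (\1_(atlas i @` B) p * Num.sqrt (\det (gram i p)))%:E).

(* The outer measure generated by the volumes in charts, hence the Riemannian
   volume on Borel sets. *)
Definition volume (A : set M) : \bar R :=
  ereal_inf [set s | exists (i : nat -> atlas_index M) (B : nat -> set M),
    [/\ forall k, <<s @open M >> (B k),
        forall k, B k `<=` cdom (atlas (i k)),
        A `<=` \bigcup_k B k &
        s = (\sum_(0 <= k <oo) chart_volume (i k) (B k))%E]].

Definition finite_volume : Prop := (volume [set: M] < +oo)%E.

Section Curvature.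
Variables (i0 : atlas_index M).
Implicit Types (p : 'rV[R]_(mdim M)) (i j k l : 'I_(mdim M)).

Definition partial i (f : 'rV[R]_(mdim M) -> R) p : R :=
  'D_(delta_mx 0 i) f p.

Definition gram_entry i j p : R := gram i0 p i j.

(* Gamma^l_{ij} *)
Definition christoffel l i j p : R :=
  2^-1 * \sum_(m < mdim M) invmx (gram i0 p) l m *
    (partial i (gram_entry j m) p + partial j (gram_entry i m) p
     - partial m (gram_entry i j) p).

(* R^l_{ijk}, with R(d_i, d_j) d_k = \sum_l R^l_{ijk} d_l and
   R(X, Y) = [nabla_X, nabla_Y] - nabla_[X, Y] *)
Definition riemann_coef l i j k p : R :=
  partial i (christoffel l j k) p - partial j (christoffel l i k) p
  + \sum_(m < mdim M) (christoffel l i m p * christoffel m j k p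
                      - christoffel l j m p * christoffel m i k p).

End Curvature.

Definition riemann x u v w : 'rV[R]_(mdim M) :=
  \row_l \sum_i \sum_j \sum_k
    u 0 i * v 0 j * w 0 k *
    riemann_coef (chart_at x) l i j k (atlas (chart_at x) x).

(* Sectional curvature of the plane spanned by u and v, assumed independent. *)
Definition sec x u v : R :=
  metric x (riemann x u v v) u /
  (metric x u u * metric x v v - metric x u v ^+ 2).

Definition bounded_sec : Prop :=
  exists K : R, forall x u v, free [:: u; v] -> `|sec x u v| <= K.

(* Operator norm of the restriction to E of the linear map A : T_x M -> T_y M. *)
Definition op_norm x y (E : {vspace 'rV[R]_(mdim M)})
    (A : 'rV[R]_(mdim M) -> 'rV[R]_(mdim M)) : \bar R :=
  ereal_sup [set (tnorm y (A v))%:E | v in [set v | v \in E /\ tnorm x v <= 1]].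

Definition orthogonal_bundles (E1 E2 : M -> {vspace 'rV[R]_(mdim M)}) : Prop :=
  forall x u v, u \in E1 x -> v \in E2 x -> metric x u v = 0.

End Riemannian.

Arguments complete_manifold {R} M.
Arguments connected_manifold {R} M.
Arguments finite_volume {R} M.
Arguments bounded_sec {R} M.

Definition invariant_bundle (R : realType) (M : manifold R) (f : M -> M)
    (E : M -> {vspace 'rV[R]_(mdim M)}) : Prop :=
  forall x, tangent_map f x @` [set v | v \in E x] = [set w | w \in E (f x)].

(* f is Anosov with stable bundle Es and unstable bundle Eu. *)
Definition anosov_splitting (R : realType) (M : riemannian_manifold R)
    (f : C1_diffeo M) (Es Eu : M -> {vspace 'rV[R]_(mdim M)}) : Prop :=
  [/\ forall x, (Es x + Eu x)%VS = fullv /\ directv (Es x + Eu x),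
      continuous_subbundle Es /\ continuous_subbundle Eu,
      invariant_bundle f Es /\ invariant_bundle f Eu &
      exists C lambda : R, [/\ 0 < C, 0 < lambda < 1 &
        forall (x : M) (n : nat),
          (op_norm x (iter n f x) (Es x) (tangent_map (iter n f) x)
             <= (C * lambda ^+ n)%:E)%E /\
          (op_norm x (iter n (diffeo_inv f) x) (Eu x)
                   (tangent_map (iter n (diffeo_inv f)) x)
             <= (C * lambda ^+ n)%:E)%E]].

Definition iterz (T : Type) (f finv : T -> T) (n : int) : T -> T :=
  match n with
  | Posz m => iter m f
  | Negz m => iter m.+1 finv
  end.

(* For a bijection f of inverse finv on a space with (extended) distance d. *)
Definition lipschitz_shadowing (R : realType) (T : Type) (d : T -> T -> \bar R)
    (f finv : T -> T) : Prop :=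
  exists L delta0 : R, [/\ 0 < L, 0 < delta0 &
    forall delta : R, 0 < delta < delta0 -> forall x : int -> T,
      (forall n : int, (d (f (x n)) (x (n + 1)%R) <= delta%:E)%E) ->
      exists z, forall n : int,
        (d (iterz f finv n z) (x n) <= (L * delta)%:E)%E].

Definition expansive (R : realType) (T : Type) (d : T -> T -> \bar R)
    (f finv : T -> T) : Prop :=
  exists2 eps : R, 0 < eps & forall x y,
    (forall n : int,
       (d (iterz f finv n x) (iterz f finv n y) <= eps%:E)%E) -> x = y.

(* Main.v *)
From mathcomp Require Import all_boot all_order all_algebra.
From mathcomp Require Import all_classical all_reals all_analysis.
From mathcomp Require Import measurable_realfun.
From mathcomp Require Import zify ring lra.
Require Import Defs.

Set Implicit Arguments.
Unset Strict Implicit.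
Unset Printing Implicit Defensive.

Import Order.TTheory GRing.Theory Num.Theory.
Import numFieldNormedType.Exports.

Local Open Scope classical_set_scope.
Local Open Scope ring_scope.

(** The manifold is M = (R^2 / L) x R, where the lattice L is the ring
    Z[sqrt 3] embedded in the plane by its two real embeddings, with the warped
    metric (dx^2 + dy^2) / (1 + t^2) + dt^2. The map is
    F (x, y, t) = (a x, y / a, 2 t), where a = 2 + sqrt 3 is a unit of
    Z[sqrt 3], so that F preserves L.

    The torus at height t has size about 1 / |t|. Hence the volume of M is a
    multiple of the integral of 1 / (1 + t^2), and the curvature is bounded
    because the warping factor varies slowly (lemma metric_riemannE computes it
    from the curvatures of the coordinate planes). Doubling t divides the size
    of the torus by at most 2, which is less than the expansion a along x. So x
    and t are expanded and y is contracted, uniformly: F is Anosov, with the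
    coordinate bundles, which are orthogonal (cat_map_anosov).

    Expansiveness fails since the torus direction becomes invisible at large
    height. Two points that differ in x by a small s at a large height T remain
    close in the past, where F contracts x, and in the future, where they lie
    on tori of diameter O(1 / T) (cat_map_not_expansive).

    Shadowing survives since the errors made along the torus shrink with it. A
    jump of length d at height t changes x and y by at most O((1 + |t|) d), and
    the weight 1 + |t| at most doubles or halves at each step of a pseudo-orbit,
    while x and y are multiplied by a > 2 or by 1 / a. Thus the geometric
    series that solve v (n + 1) = F (v n) + error n converge, with sums of the
    order of the weight: this is contracting_recurrence and
    expanding_recurrence, and v is the correction of the pseudo-orbit to an
    orbit.

    The passage between the Riemannian distance and coordinates is the content
    of rdist_le, which measures segments, and of rdist_displacement. For the
    latter, a curve of M is lifted to R^3 by integrating its velocity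
    (curve_lift); its length bounds the variation of t, hence from below the
    size of the torus along the curve, hence the variation of x and y.

    The charts are the local inverses of the projection of R^3 on the quotient,
    so that all coordinate changes are locally translations and all maps
    induced by linear ones are locally affine. *)

(** * Quotients of R^m by discrete groups of translations *)

(** A discrete group of translations of R^m. Discreteness is witnessed by a
    cell, a neighbourhood of 0 without two equivalent points, whose translates
    serve as chart domains. *)
Record translations (R : realType) (m : nat) := Translations {
  translation :> 'rV[R]_m -> Prop;
  translation0 : translation 0;
  translationB : forall p q,
    translation p -> translation q -> translation (p - q);
  cell : set 'rV[R]_m;
  cell_open : open cell;
  cell0 : cell 0;
  cell_inj : forall p q, cell p -> cell q -> translation (p - q) -> p = q
}.

Section QuotientSpace.
Context {R : realType} {m : nat} (G : translations R m).
Local Notation V := 'rV[R]_m.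

Lemma shift_continuous (w : V) : continuous (fun q : V => q + w).
Proof. by move=> q; apply: continuousD; [exact: cvg_id|exact: cst_continuous]. Qed.

Lemma translationN p : G p -> G (- p).
Proof. by move=> Gp; rewrite -sub0r; apply: translationB => //; exact: translation0. Qed.

Lemma translationD p q : G p -> G q -> G (p + q).
Proof. by move=> Gp /translationN Gq; rewrite -[q]opprK; exact: translationB. Qed.

Definition same_orbit : rel V := fun p q => `[< G (p - q) >].

Lemma same_orbit_refl : reflexive same_orbit.
Proof. by move=> p; apply/asboolP; rewrite subrr; exact: translation0. Qed.

Lemma same_orbit_sym : symmetric same_orbit.
Proof.
by move=> p q; apply/idP/idP => /asboolP /translationN;
  rewrite opprB => h; apply/asboolP.
Qed.

Lemma same_orbit_trans : transitive same_orbit.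
Proof.
move=> q p r /asboolP pq /asboolP qr; apply/asboolP.
by have := translationD pq qr; rewrite addrA subrK.
Qed.

Canonical same_orbit_equiv :=
  EquivRel same_orbit same_orbit_refl same_orbit_sym same_orbit_trans.

Definition orbit_space : topologicalType :=
  quotient_topology {eq_quot same_orbit_equiv}%qT.

Definition proj : V -> orbit_space :=
  (\pi_(quotient_topology {eq_quot same_orbit_equiv}%qT))%qT.

Definition lift (x : orbit_space) : V :=
  repr (x : quotient_topology {eq_quot same_orbit_equiv}%qT).

Lemma liftK : cancel lift proj.
Proof. by move=> x; exact: reprK. Qed.

Lemma projP p q : proj p = proj q <-> G (p - q).
Proof.
split => [/(@eqquotP _ _ {eq_quot same_orbit_equiv}%qT)/asboolP //|Gpq].
by apply/(@eqquotP _ _ {eq_quot same_orbit_equiv}%qT)/asboolP.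
Qed.

Lemma proj_translate p v : G v -> proj (p + v) = proj p.
Proof. by move=> Gv; apply/projP; rewrite addrAC subrr add0r. Qed.

Lemma lift_proj p : exists2 v, G v & lift (proj p) = p + v.
Proof.
exists (lift (proj p) - p); last by rewrite addrC subrK.
by apply/projP; rewrite liftK.
Qed.

Lemma proj_continuous : continuous proj.
Proof. exact: pi_continuous. Qed.

Lemma openE_proj (U : set orbit_space) : open U = open (proj @^-1` U).
Proof. by []. Qed.

(** The preimage of the image of an open set is a union of translates. *)
Lemma proj_open (U : set V) : open U -> open (proj @` U).
Proof.
move=> oU; rewrite openE_proj.
have -> : proj @^-1` (proj @` U) =
    \bigcup_(v in [set v | G v]) ((fun p => p + v) @^-1` U).
  apply/seteqP; split => p /=.
    move=> [q Uq /projP Gqp]; exists (q - p) => //=.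
    by rewrite addrC subrK.
  by move=> [v Gv /= Upv]; exists (p + v) => //; exact: proj_translate.
apply: bigcup_open => v _; apply: open_comp => [p _|//].
exact: shift_continuous.
Qed.

(** Only one translate of 0 can be close to p, so translates of 0 stay away
    from any p that is not one of them. *)
Lemma translation_away p : ~ G p ->
  exists2 e : R, 0 < e & forall v, G v -> ~ `|p - v| < e.
Proof.
move=> nGp; apply: contrapT => noe.
have near_p e : 0 < e -> exists2 v, G v & `|p - v| < e.
  move=> e0; apply: contrapT => nov; apply: noe; exists e => // v Gv pv.
  by apply: nov; exists v.
have /nbhs_ballP[r /= r0 rcell] : nbhs (0 : V) (cell G).
  by apply: open_nbhs_nbhs; split; [exact: cell_open|exact: cell0].
have [v Gv pv] := near_p _ (divr_gt0 r0 (ltr0n _ 2)).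
have pv0 : 0 < `|p - v|.
  by rewrite normr_gt0; apply/eqP => /subr0_eq pv'; apply: nGp; rewrite pv'.
have [w Gw pw] : exists2 w, G w & `|p - w| < Num.min (r / 2) `|p - v|.
  by apply: near_p; rewrite lt_min pv0 divr_gt0.
move: pw; rewrite lt_min => /andP[pw pwv].
suff : v - w = 0 by move=> /subr0_eq vw; move: pwv; rewrite vw ltxx.
apply: (@cell_inj _ _ G); [|exact: cell0|rewrite subr0; exact: translationB].
apply: rcell; rewrite -ball_normE /ball_ /= sub0r normrN.
have -> : v - w = (p - w) - (p - v) by rewrite opprB [RHS]addrC addrA subrK.
rewrite (le_lt_trans (ler_normB _ _))// [ltRHS](splitr r); exact: ltrD.
Qed.

Lemma orbit_space_hausdorff : hausdorff_space orbit_space.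
Proof.
rewrite open_hausdorff => x y /eqP xy.
have [e e0 He] : exists2 e : R, 0 < e & forall v, G v -> ~ `|(lift x - lift y) - v| < e.
  by apply: translation_away => /projP; rewrite !liftK.
have openB (p : V) (r : R) : open (proj @` ball p r).
  by apply: proj_open; exact: ball_open.
exists (proj @` ball (lift x) (e / 2), proj @` ball (lift y) (e / 2)).
  split; apply/mem_set => /=; [exists (lift x)|exists (lift y)];
    rewrite ?liftK//; apply: ballxx; exact: divr_gt0.
split; [exact: openB|exact: openB|apply/eqP].
apply/seteqP; split => // z [/= [p xp pz] [q yq]]; rewrite -pz => /projP Gqp.
apply: (He _ (translationN Gqp)).
rewrite -!ball_normE /ball_ /= in xp yq.
have -> : lift x - lift y - - (q - p) = (lift x - p) - (lift y - q).
  by apply/rowP => i; rewrite !mxE; ring.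
by rewrite (le_lt_trans (ler_normB _ _))// [ltRHS](splitr e); exact: ltrD.
Qed.

(** The images of the balls with rational centres and radii 1 / (k + 1) form a
    basis, again because proj is open. *)
Lemma orbit_space_second_countable : @second_countable orbit_space.
Proof.
pose B (qk : 'rV[rat]_m * nat) :=
  proj @` ball (map_mx (@ratr R) qk.1) (qk.2.+1%:R^-1 : R).
exists (range B).
  by apply: (@card_le_trans _ _ _ [set: 'rV[rat]_m * nat]);
    [exact: card_image_le|exact: countableP].
split=> [_ [qk _ <-]|x U].
  by apply: proj_open; exact: ball_open.
rewrite nbhsE => -[W [oW Wx] WU].
have /nbhs_ballP[r /= r0 rW] : nbhs (lift x) (proj @^-1` W).
  by apply: open_nbhs_nbhs; split; [rewrite -openE_proj|rewrite /= liftK].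
have [k _ /(_ k (leqnn k)) /= kr] :=
  near_infty_natSinv_lt (PosNum (divr_gt0 r0 (ltr0n _ 2))).
have k0 : (0 : R) < k.+1%:R^-1 by rewrite invr_gt0.
have /choice[q Hq] : forall i : 'I_m, exists q : rat,
    `|lift x 0 i - ratr q| < (k.+1%:R^-1 : R).
  move=> i; have [|q] := @rat_in_itvoo R (lift x 0 i - k.+1%:R^-1) (lift x 0 i + k.+1%:R^-1).
    by rewrite ltrD2l gtrN.
  by rewrite in_itv/= => Hq; exists q; rewrite ltr_distlC.
pose c : 'rV[rat]_m := \row_i q i.
have bc : ball (map_mx (@ratr R) c) (k.+1%:R^-1 : R) (lift x).
  split => // i j; rewrite !mxE (ord1 i) -ball_normE /ball_ /= distrC.
  exact: Hq.
exists (B (c, k)) => //=.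
  split; first by exists (c, k).
  by exists (lift x); rewrite ?liftK.
move=> _ [p pc <-]; apply: WU; apply: rW.
apply: (@le_ball _ _ _ (k.+1%:R^-1 + k.+1%:R^-1)).
  by rewrite [leRHS](splitr r); apply: ltW; apply: ltrD.
by apply: ball_triangle pc; exact: ball_sym.
Qed.

(** The images of the lines through 0 cover the quotient. *)
Lemma orbit_space_connected : connected [set: orbit_space].
Proof.
have -> : [set: orbit_space] =
    \bigcup_(v in [set: V]) ((fun s : R => proj (s *: v)) @` setT).
  apply/seteqP; split => // x _; exists (lift x) => //.
  by exists 1 => //; rewrite scale1r liftK.
apply: bigcup_connected => [|v _].
  by exists (proj 0) => v _; exists 0 => //; rewrite scale0r.
apply: connected_continuous_connected.
  by apply/connected_intervalP => ? ? ? ? ?.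
apply: continuous_subspaceT => s.
apply: continuous_comp; last exact: proj_continuous.
exact: scalel_continuous.
Qed.

(** ** Charts: a translate of the cell projects injectively *)

Definition chart_dom (c : V) : set orbit_space :=
  [set x | exists2 p, cell G (p - c) & proj p = x].

Definition coord (c : V) (x : orbit_space) : V :=
  xget 0 [set p | cell G (p - c) /\ proj p = x].

Lemma coordP c x : chart_dom c x -> cell G (coord c x - c) /\ proj (coord c x) = x.
Proof.
by move=> [p cp px]; rewrite /coord; case: xgetP => [q _ //|/(_ p)]; case.
Qed.

Lemma coord_proj c p : cell G (p - c) -> coord c (proj p) = p.
Proof.
move=> cp; have [|cq qp] := @coordP c (proj p); first by exists p.
apply: (addIr (- c)); apply: (@cell_inj _ _ G) => //.
by rewrite opprB addrA subrK; apply/projP.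
Qed.

Lemma chart_dom_proj c p : cell G (p - c) -> chart_dom c (proj p).
Proof. by exists p. Qed.

Lemma chart_domE c : chart_dom c = proj @` [set p | cell G (p - c)].
Proof. by apply/seteqP; split => x [p]; exists p. Qed.

Lemma cell_shift_open c : open [set p | cell G (p - c)].
Proof.
apply: open_comp => [p _|]; last exact: cell_open.
exact: shift_continuous.
Qed.

Lemma coord_image c : coord c @` chart_dom c = [set p | cell G (p - c)].
Proof.
apply/seteqP; split => [_ [x /coordP[cx _] <-] //|p cp].
by exists (proj p); [exact: chart_dom_proj|exact: coord_proj].
Qed.

Lemma chart_dom_open c : open (chart_dom c).
Proof. by rewrite chart_domE; apply: proj_open; exact: cell_shift_open. Qed.

(** The inverse of proj on a cell is continuous since proj is open. *)
Lemma coord_continuous_at c x : chart_dom c x -> {for x, continuous (coord c)}.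
Proof.
move=> cx U /=; rewrite nbhsE => -[W [oW Wx] WU].
have [ccx pcx] := coordP cx.
apply: (@filterS _ (nbhs x) _ (proj @` (W `&` [set p | cell G (p - c)]))); last first.
  apply: open_nbhs_nbhs; split; last by exists (coord c x).
  by apply: proj_open; apply: openI => //; exact: cell_shift_open.
by move=> _ [p [Wp cp] <-]; apply: WU; rewrite coord_proj.
Qed.

Definition quotient_chart (c : V) : chart R m orbit_space.
Proof.
apply: (@Chart R m orbit_space (chart_dom c) (coord c) proj).
- exact: chart_dom_open.
- by rewrite coord_image; exact: cell_shift_open.
- by move=> x /coordP[].
- exact: coord_continuous_at.
- by move=> p _; exact: proj_continuous.
Defined.

End QuotientSpace.

(** * Locally affine maps *)

Section LocallyAffine.
Context {R : realType} {m n : nat}.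
Local Notation V := 'rV[R]_m.
Local Notation W := 'rV[R]_n.
Implicit Types (f : V -> W) (A : 'M[R]_(m, n)).

Lemma mulmxr_continuous A : continuous (fun v : V => v *m A).
Proof.
have -> : (fun v : V => v *m A) = (fun v => \sum_(i < m) v 0 i *: row i A).
  by apply/funext => v; rewrite mulmx_sum_row.
elim: (index_enum _) => [|i s IH].
  under eq_fun do rewrite big_nil; exact: cst_continuous.
under eq_fun do rewrite big_cons.
move=> v.
have cv : {for v, continuous (fun u : V => u 0 i *: row i A)}.
  apply: differentiable_continuous.
  apply: (@differentiableZl _ _ _ (fun u : V => u 0 i)).
  exact: differentiable_coord.
exact: (cvgD cv (IH v)).
Qed.

(** Differentiability and the differential only depend on the germ. *)
Lemma affine_germ_diff f p A b : (\forall q \near p, f q = q *m A + b) ->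
  differentiable f p /\ 'd f p = mulmxr A :> (V -> W).
Proof.
move=> fA.
have cA : continuous (mulmxr A : V -> W) by exact: mulmxr_continuous.
have E : f \o shift p = cst (f p) + (mulmxr A : V -> W) +o_ 0 id.
  apply/eqaddoP => _/posnumP[e].
  have : \forall h \near (0 : V), f (h + p) = (h + p) *m A + b.
    by move: fA; rewrite (near_shift 0 p)/= subr0.
  apply: filterS => h fh.
  rewrite [X in `|X|](_ : _ = 0) ?normr0//.
  rewrite /= fctE /= fh (nbhs_singleton fA) mulmxDl /=.
  by apply/rowP => i; rewrite !mxE; ring.
have D : 'd f p = mulmxr A :> (V -> W) by exact: diff_unique.
by split => //; apply/diff_locallyP; rewrite D.
Qed.

Definition locally_affine (U : set V) f := forall p, U p ->
  exists A b, \forall q \near p, f q = q *m A + b.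

(** Each partial derivative of a locally affine map is locally constant. *)
Lemma locally_affine_Coo (U : set V) f : locally_affine U f -> Coo U f.
Proof.
move=> fU k; elim: k f fU => [|k IH] f fU; split => //.
- by move=> p /fU[A [b /affine_germ_diff[/differentiable_continuous]]].
- by move=> p /fU[A [b /affine_germ_diff[/differentiable_continuous]]].
move=> i; split => [p /fU[A [b /affine_germ_diff[dfp _]]]|].
  exact: diff_derivable.
apply: IH => p /fU[A [b fA]]; exists 0, (row i A).
apply: filterS (nbhs_interior fA) => q /affine_germ_diff[dfq dE].
by rewrite deriveE// dE /= mulmx0 add0r -rowE.
Qed.

End LocallyAffine.

(** * The quotient as a manifold, and its linear self-maps *)

Section QuotientManifold.
Context {R : realType} {m : nat} (G : translations R m).
Local Notation V := 'rV[R]_m.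
Local Notation proj := (@proj R m G).
Local Notation coord := (@coord R m G).

Lemma coord_near (c p : V) : chart_dom c (proj p) ->
  exists2 v, G v & \forall q \near p, coord c (proj q) = q + v.
Proof.
move=> /coordP[ccp /projP Gcp].
exists (coord c (proj p) - p) => //.
have : nbhs p [set q | cell G (q + (coord c (proj p) - p) - c)].
  apply: open_nbhs_nbhs; split; last by rewrite /= (addrC p) subrK.
  apply: (@open_comp _ _ (fun q : V => q + (coord c (proj p) - p))
            [set q | cell G (q - c)]) => [q _|].
    exact: shift_continuous.
  exact: cell_shift_open.
by apply: filterS => q cq; rewrite -[in LHS](proj_translate q Gcp) coord_proj.
Qed.

Lemma chart_dom_lift (x : orbit_space G) : chart_dom (lift x) x.
Proof. by exists (lift x); rewrite ?subrr ?liftK//; exact: cell0. Qed.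

Lemma coord_lift (x : orbit_space G) : coord (lift x) x = lift x.
Proof. by rewrite -{2}(liftK x) coord_proj// subrr; exact: cell0. Qed.

(** Coordinate changes are locally translations by elements of the group. *)
Lemma transition_locally_affine (i j : V) :
  locally_affine (coord i @` (chart_dom i `&` chart_dom j)) (coord j \o proj).
Proof.
move=> _ [x [xi xj] <-]; have [_ px] := coordP xi.
have [|v _ Hv] := @coord_near j (coord i x); first by rewrite px.
by exists 1%:M, v; apply: filterS Hv => q /=; rewrite mulmx1.
Qed.

Hypothesis m_gt0 : (0 < m)%N.

Definition quotient_manifold : manifold R :=
  @Manifold R (orbit_space G) m m_gt0 (@orbit_space_hausdorff R m G)
    (@orbit_space_second_countable R m G) V (quotient_chart G)
    (@lift R m G) chart_dom_lift
    (fun i j => locally_affine_Coo (@transition_locally_affine i j)).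

Local Notation M := quotient_manifold.

Section LinearMap.
Variable A : 'M[R]_m.
Hypothesis GA : forall v, G v -> G (v *m A).

Definition linear_map (x : M) : M := proj (lift x *m A).

Lemma linear_map_proj p : linear_map (proj p) = proj (p *m A).
Proof.
rewrite /linear_map; have [v Gv ->] := lift_proj G p.
by rewrite mulmxDl proj_translate//; exact: GA.
Qed.

Lemma linear_map_continuous : continuous linear_map.
Proof.
apply/(@quotient_continuous _ _ _ linear_map).
have -> : linear_map \o proj = proj \o (fun p : V => p *m A).
  by apply/funext => p; exact: linear_map_proj.
move=> p; apply: continuous_comp; first exact: mulmxr_continuous.
exact: proj_continuous.
Qed.

Lemma linear_map_near (j : V) p : chart_dom j (proj (p *m A)) ->
  exists b, \forall q \near p, coord j (linear_map (proj q)) = q *m A + b.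
Proof.
move=> /coord_near[b _ Hb]; exists b.
have H : \forall q \near p, coord j (proj (q *m A)) = q *m A + b.
  exact: (@mulmxr_continuous R m m A p _ Hb).
by apply: filterS H => q; rewrite linear_map_proj.
Qed.

Lemma linear_map_C1 : @C1_map R M linear_map.
Proof.
split; first exact: linear_map_continuous.
move=> i j; apply: (@locally_affine_Coo R m m).
move=> _ [x [xi xj] <-]; have [_ px] := coordP xi.
rewrite /preimage/= -px linear_map_proj in xj.
by have [b Hb] := linear_map_near xj; exists A, b.
Qed.

Lemma linear_map_tangent x :
  @tangent_map R M linear_map x = (fun v => v *m A).
Proof.
rewrite /tangent_map /= coord_lift.
have [b Hb] : exists b, \forall q \near lift x,
    coord (lift (linear_map x)) (linear_map (proj q)) = q *m A + b.
  apply: linear_map_near; rewrite -linear_map_proj liftK.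
  exact: chart_dom_lift.
by have [_ ->] := affine_germ_diff Hb.
Qed.

End LinearMap.

Lemma tangent_coord_id (i : V) (x : M) : chart_dom i x ->
  @tangent_coord R M i x = id.
Proof.
rewrite /tangent_coord /= coord_lift => xi.
have [|b _ Hb] := @coord_near i (lift x); first by rewrite liftK.
have Hb1 : \forall q \near lift x, (coord i \o proj) q = q *m 1%:M + b.
  by apply: filterS Hb => q; rewrite mulmx1.
have [_ ->] := affine_germ_diff Hb1.
by apply/funext => v /=; rewrite mulmx1.
Qed.

Lemma transition_diff_id (i j : V) (x : M) : chart_dom i x -> chart_dom j x ->
  'd (coord j \o proj) (coord i x) = id :> (V -> V).
Proof.
move=> xi xj; have [_ px] := coordP xi.
have [|b _ Hb] := @coord_near j (coord i x); first by rewrite px.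
have Hb1 : \forall q \near coord i x, (coord j \o proj) q = q *m 1%:M + b.
  by apply: filterS Hb => q; rewrite mulmx1.
have [_ ->] := affine_germ_diff Hb1.
by apply/funext => v /=; rewrite mulmx1.
Qed.

End QuotientManifold.

(** * The three-dimensional example: a torus times a line *)

Section Coordinates.
Context {R : realType}.

Definition i0 : 'I_3 := @Ordinal 3 0 isT.
Definition i1 : 'I_3 := @Ordinal 3 1 isT.
Definition i2 : 'I_3 := @Ordinal 3 2 isT.

Lemma forall_ord3 (P : 'I_3 -> Prop) : P i0 -> P i1 -> P i2 -> forall i, P i.
Proof.
move=> P0 P1 P2 [[|[|[|//]]] Hi].
- by rewrite (_ : Ordinal Hi = i0)//; exact: val_inj.
- by rewrite (_ : Ordinal Hi = i1)//; exact: val_inj.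
- by rewrite (_ : Ordinal Hi = i2)//; exact: val_inj.
Qed.

Lemma sum_ord3 (V : nmodType) (f : 'I_3 -> V) :
  \sum_(i < 3) f i = f i0 + f i1 + f i2.
Proof.
rewrite !big_ord_recl big_ord0 addr0 addrA.
by congr (f _ + f _ + f _); exact: val_inj.
Qed.

Definition vec3 (a b c : R) : 'rV[R]_3 := \row_i nth 0 [:: a; b; c] i.

Lemma vec3_0 a b c : vec3 a b c 0 i0 = a. Proof. by rewrite mxE. Qed.
Lemma vec3_1 a b c : vec3 a b c 0 i1 = b. Proof. by rewrite mxE. Qed.
Lemma vec3_2 a b c : vec3 a b c 0 i2 = c. Proof. by rewrite mxE. Qed.

Lemma vec3P (p q : 'rV[R]_3) : p 0 i0 = q 0 i0 -> p 0 i1 = q 0 i1 ->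
  p 0 i2 = q 0 i2 -> p = q.
Proof. by move=> e0 e1 e2; apply/rowP; exact: forall_ord3. Qed.

End Coordinates.

Definition vec3E := (@vec3_0, @vec3_1, @vec3_2).

Section Lattice.
Context {R : realType}.
Local Notation V := 'rV[R]_3.

Definition sqrt3 : R := Num.sqrt 3.

Lemma sqrt3_sqr : sqrt3 ^+ 2 = 3.
Proof. by rewrite sqr_sqrtr. Qed.

Lemma sqrt3_ge0 : 0 <= sqrt3.
Proof. exact: sqrtr_ge0. Qed.

Lemma sqrt3_gt : 17 / 10 < sqrt3.
Proof.
have := sqrt3_sqr; have := sqrt3_ge0; rewrite ltNge => s0 s2.
by apply/negP => s3; nra.
Qed.

Lemma sqrt3_lt : sqrt3 < 7 / 4.
Proof.
have := sqrt3_sqr; have := sqrt3_ge0; rewrite ltNge => s0 s2.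
by apply/negP => s3; nra.
Qed.

(** The exponent of 3 is even in m^2 and odd in 3 n^2. *)
Lemma sqr_eq_3sqr (m n : int) : m ^+ 2 = 3 * n ^+ 2 -> n = 0.
Proof.
move=> e; apply/eqP; rewrite -absz_eq0; apply/contraT; rewrite -lt0n => n0.
have eN : (`|m| ^ 2 = 3 * `|n| ^ 2)%N.
  by have := congr1 absz e; rewrite abszM !abszX.
have m0 : (0 < `|m|)%N.
  by rewrite lt0n; apply/eqP => m0; move: eN; rewrite m0 exp0n// => /esym/eqP;
     rewrite muln_eq0 expn_eq0/= -leqn0 leqNgt n0.
have := congr1 (fun k => odd (logn 3 k)) eN => /=.
by rewrite lognM ?expn_gt0 ?n0// !lognX oddD !oddM.
Qed.

(** The ring Z[sqrt 3] in the plane t = 0, embedded by both choices of the sign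
    of sqrt 3. *)
Definition lattice (v : V) : Prop := v 0 i2 = 0 /\ exists m n : int,
  v 0 i0 = m%:~R + n%:~R * sqrt3 /\ v 0 i1 = m%:~R - n%:~R * sqrt3.

(** The product of the first two coordinates is the norm m^2 - 3 n^2 of an
    algebraic integer, which vanishes only at 0 as 3 is not a square. *)
Lemma lattice_norm (v : V) : lattice v -> `|v 0 i0 * v 0 i1| < 1 -> v = 0.
Proof.
move=> [v2 [m [n [e0 e1]]]].
have -> : v 0 i0 * v 0 i1 = (m ^+ 2 - 3 * n ^+ 2)%:~R.
  rewrite e0 e1 rmorphB /= [(3 * _)%:~R]rmorphM /= !rmorphXn /=.
  have -> : (3 : int)%:~R = sqrt3 ^+ 2 :> R by rewrite sqrt3_sqr.
  ring.
rewrite -intr_norm -[1]/(1%:~R) ltr_int -[1]add0r ltzD1 normr_le0 subr_eq0.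
move=> /eqP mn; have n0 := sqr_eq_3sqr mn.
move: mn e0 e1; rewrite n0 expr0n mulr0 => /eqP; rewrite sqrf_eq0 => /eqP ->.
by rewrite mul0r addr0 subr0 => e0 e1; apply: vec3P; rewrite ?e0 ?e1 ?v2 mxE.
Qed.

Definition lattice_cell : set V :=
  [set v | `|v 0 i0| < 1 / 2 /\ `|v 0 i1| < 1 / 2].

Lemma lattice_cell_open : open lattice_cell.
Proof.
have oj j : open [set v : V | `|v 0 j| < 1 / 2].
  apply: (@open_comp _ _ (fun v : V => `|v 0 j|) [set x : R | x < 1 / 2]).
    move=> v _; apply: continuous_comp; last exact: norm_continuous.
    exact: coord_continuous.
  exact: open_lt.
exact: (openI (oj i0) (oj i1)).
Qed.

Lemma lattice_cell_inj p q : lattice_cell p -> lattice_cell q ->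
  lattice (p - q) -> p = q.
Proof.
move=> [p0 p1] [q0 q1] /lattice_norm H; apply/subr0_eq; apply: H.
rewrite !mxE normrM.
have half : 1 = 1 / 2 + 1 / 2 :> R by lra.
apply: mulr_ilt1 => //; rewrite (le_lt_trans (ler_normB _ _))// half; exact: ltrD.
Qed.

Lemma lattice0 : lattice 0.
Proof. by split; [|exists 0, 0]; rewrite !mxE ?mul0r ?addr0 ?subr0. Qed.

Lemma latticeB p q : lattice p -> lattice q -> lattice (p - q).
Proof.
move=> [p2 [m [n [p0 p1]]]] [q2 [m' [n' [q0 q1]]]]; split.
  by rewrite !mxE p2 q2 subr0.
by exists (m - m'), (n - n'); rewrite !mxE p0 p1 q0 q1 !rmorphB/=; split; ring.
Qed.

Lemma lattice_cell0 : lattice_cell 0.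
Proof. by split; rewrite mxE normr0; lra. Qed.

Definition torus_line : translations R 3 :=
  Translations lattice0 latticeB lattice_cell_open
    lattice_cell0 lattice_cell_inj.

(** Rounding the coordinates on the basis 1, sqrt 3 leaves remainders of size
    at most 1 + sqrt 3, which 3 bounds. *)
Lemma lattice_reduce (a b : R) : exists2 v, lattice v &
  v 0 i2 = 0 /\ (`|a + v 0 i0| <= 3 /\ `|b + v 0 i1| <= 3).
Proof.
have s0 := sqrt3_gt; have s1 := sqrt3_lt; have s2 := sqrt3_sqr.
pose m := Num.floor ((a + b) / 2); pose n := Num.floor ((a - b) / (2 * sqrt3)).
have /andP[m0 m1] := floor_itv ((a + b) / 2).
have /andP[n0 n1] := floor_itv ((a - b) / (2 * sqrt3)).
rewrite -/m -/n !intrD !mulr1z in m0 m1 n0 n1.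
pose x := (a + b) / 2 - m%:~R; pose y := (a - b) / (2 * sqrt3) - n%:~R.
have sN0 : sqrt3 != 0 by apply/eqP; move: s0 => /[swap] ->; lra.
have ea : a = x + y * sqrt3 + (m%:~R + n%:~R * sqrt3).
  by rewrite /x /y; field; rewrite sN0.
have eb : b = x - y * sqrt3 + (m%:~R - n%:~R * sqrt3).
  by rewrite /x /y; field; rewrite sN0.
have hx : 0 <= x <= 1 by rewrite /x; apply/andP; split; lra.
have hy : 0 <= y <= 1 by rewrite /y; apply/andP; split; lra.
exists (vec3 (- (m%:~R + n%:~R * sqrt3)) (- (m%:~R - n%:~R * sqrt3)) 0).
  split; first by rewrite vec3E.
  by exists (- m), (- n); rewrite !vec3E !rmorphN /=; split; ring.
rewrite !vec3E; split => //.
by rewrite {1}ea {1}eb !addrK !ler_norml; split; apply/andP; split; nra.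
Qed.

End Lattice.

(** ** The metric *)

Section Metric.
Context {R : realType}.
Local Notation V := 'rV[R]_3.

(** The squared size of the torus at height t. *)
Definition warp (t : R) : R := (1 + t ^+ 2)^-1.

Lemma warp_den_gt0 (t : R) : 0 < 1 + t ^+ 2.
Proof. by rewrite ltr_wpDr ?sqr_ge0. Qed.

Lemma warp_gt0 t : 0 < warp t.
Proof. by rewrite invr_gt0 warp_den_gt0. Qed.

Definition torus_block : 'M[R]_3 := diag_mx (vec3 1 1 0).
Definition line_block : 'M[R]_3 := diag_mx (vec3 0 0 1).

(** Isolating the constant blocks makes the scalar factor the only thing to
    differentiate. *)
Definition metric_mx (t : R) : 'M[R]_3 := warp t *: torus_block + line_block.

Lemma metric_mx_sym t : (metric_mx t)^T = metric_mx t.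
Proof. by rewrite linearD linearZ /= !tr_diag_mx. Qed.

Lemma metric_mxE t i j :
  metric_mx t i j = (i == j)%:R * (if i == i2 then 1 else warp t).
Proof.
rewrite !mxE.
by move: i j; do 2 apply: forall_ord3; rewrite /= ?mulr1n ?mulr0n; ring.
Qed.

Lemma metric_mx_form t (u v : V) : (u *m metric_mx t *m v^T) 0 0 =
  warp t * (u 0 i0 * v 0 i0 + u 0 i1 * v 0 i1) + u 0 i2 * v 0 i2.
Proof.
by rewrite mxE sum_ord3 !mxE !sum_ord3 !metric_mxE /=; ring.
Qed.

Lemma metric_mx_pos t (v : V) : v != 0 -> 0 < (v *m metric_mx t *m v^T) 0 0.
Proof.
move=> v0; rewrite metric_mx_form -!expr2.
have w0 := warp_gt0 t.
have s0 := sqr_ge0 (v 0 i0); have s1 := sqr_ge0 (v 0 i1).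
have s2 := sqr_ge0 (v 0 i2).
rewrite lt_neqAle; apply/andP; split; last first.
  by rewrite addr_ge0// mulr_ge0 ?addr_ge0// ltW.
apply: contra v0 => /eqP e; apply/eqP.
have w1 : 0 <= warp t * v 0 i0 ^+ 2 by rewrite mulr_ge0// ltW.
have w2 : 0 <= warp t * v 0 i1 ^+ 2 by rewrite mulr_ge0// ltW.
have e0 : warp t * v 0 i0 ^+ 2 == 0 by apply/eqP; lra.
have e1 : warp t * v 0 i1 ^+ 2 == 0 by apply/eqP; lra.
have e2 : v 0 i2 ^+ 2 == 0 by apply/eqP; lra.
rewrite mulf_eq0 gt_eqF//= sqrf_eq0 in e0.
rewrite mulf_eq0 gt_eqF//= sqrf_eq0 in e1.
rewrite sqrf_eq0 in e2.
by apply: vec3P; rewrite ?(eqP e0) ?(eqP e1) ?(eqP e2) mxE.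
Qed.

Lemma is_derive_warp (t : R) :
  is_derive t (1 : R) warp (- (2 * t) * warp t ^+ 2).
Proof.
have d0 : 1 + t ^+ 2 != 0 by rewrite gt_eqF ?warp_den_gt0.
have dd : is_derive t (1 : R) (fun t : R => 1 + t ^+ 2) (2 * t).
  by apply: is_derive_eq; rewrite /GRing.scale/=; ring.
have dV := @is_deriveV _ (fun t : R => 1 + t ^+ 2) _ _ _ d0 dd.
by apply: is_derive_eq; rewrite /GRing.scale/= /warp -exprVn; ring.
Qed.

(** Quotients of polynomials by powers of 1 + t^2 are stable under
    differentiation, whence smoothness of all functions at hand. *)
Lemma is_derive_poly_warp (q : {poly R}) k (t : R) :
  is_derive t (1 : R) (fun t => q.[t] * warp t ^+ k)
    ((q^`() * (1 + 'X^2) - (2 * k%:R) *: (q * 'X)).[t] * warp t ^+ k.+1).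
Proof.
have dw := is_derive_warp t.
have wE : (1 + t ^+ 2) * warp t = 1 by rewrite mulfV// gt_eqF ?warp_den_gt0.
case: k => [|k].
  under eq_fun do rewrite expr0 mulr1.
  apply: is_derive_eq.
  by rewrite !hornerE subr0 -mulrA wE mulr1.
have dq := is_derive_poly q t.
have dwk : is_derive t (1 : R) (warp ^+ k.+1)
    ((k.+1%:R * warp t ^+ k) *: (- (2 * t) * warp t ^+ 2)) by exact: is_deriveX.
have -> : (fun t => q.[t] * warp t ^+ k.+1) = horner q * warp ^+ k.+1.
  by apply/funext => u; rewrite !fctE.
apply: is_derive_eq.
have qE : q^`().[t] = q^`().[t] * ((1 + t ^+ 2) * warp t) by rewrite wE mulr1.
rewrite !fctE (exprS _ k.+1) (exprS _ k) !hornerE /GRing.scale/= [in LHS]qE.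
ring.
Qed.

Lemma derive_height (f : R -> R) (df : R) (p v : V) :
  is_derive (p 0 i2) (1 : R) f df ->
  is_derive p v (fun q : V => f (q 0 i2)) (v 0 i2 * df).
Proof.
move=> [/derivable1_diffP dff <-].
have dc : differentiable (fun q : V => q 0 i2) p by exact: differentiable_coord.
have dfc : differentiable (f \o (fun q : V => q 0 i2)) p by exact: differentiable_comp.
apply: DeriveDef; first exact: diff_derivable.
have dcv : 'd (fun q : V => q 0 i2) p v = v 0 i2.
  rewrite -deriveE//.
  have dm : derivable (id : V -> V) p v by exact: derivable_id.
  have := @derive_mx R V 1 3 id p v dm.
  by rewrite derive_id => /(congr1 (fun q : V => q 0 i2)); rewrite mxE.
rewrite deriveE// diff_comp//= dcv -[v 0 i2 in LHS]mulr1 [LHS]linearZ.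
by rewrite deriveE.
Qed.

Lemma poly_warp_diff (q : {poly R}) k (E E' : 'M[R]_3) (p v : V) :
  let f := fun p : V => (q.[p 0 i2] * warp (p 0 i2) ^+ k) *: E + E' in
  differentiable f p /\ 'D_v f p =
    (v 0 i2 * ((q^`() * (1 + 'X^2) - (2 * k%:R) *: (q * 'X)).[p 0 i2] *
               warp (p 0 i2) ^+ k.+1)) *: E.
Proof.
have dq := is_derive_poly_warp q k (p 0 i2).
pose g := fun p : V => q.[p 0 i2] * warp (p 0 i2) ^+ k.
have dg : differentiable g p.
  have dc : differentiable (fun q : V => q 0 i2) p by exact: differentiable_coord.
  apply: (@differentiable_comp _ _ _ _ (fun q : V => q 0 i2)
            (fun t => q.[t] * warp t ^+ k)) => //.
  by apply/derivable1_diffP; case: dq.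
have dgE : differentiable (fun p => g p *: E) p by exact: differentiableZl.
have dgv : is_derive p v (fun p => g p *: E) ('D_v g p *: E).
  apply: DeriveDef; first exact: diff_derivable.
  by rewrite deriveE// diffZl// -deriveE.
split; first exact: (differentiableD dgE (differentiable_cst E' p)).
have [_ ->] := is_deriveD dgv (is_derive_cst E' p v).
by rewrite addr0; have [_ ->] := derive_height v dq.
Qed.

Lemma poly_warp_Coo (U : set V) (q : {poly R}) k (E E' : 'M[R]_3) :
  Coo U (fun p : V => (q.[p 0 i2] * warp (p 0 i2) ^+ k) *: E + E').
Proof.
move=> j; elim: j q k E' => [|j IH] q k E'; split.
- by move=> p _; apply: differentiable_continuous; case: (poly_warp_diff q k E E' p 0).
- exact: I.
- by move=> p _; apply: differentiable_continuous; case: (poly_warp_diff q k E E' p 0).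
move=> i; split.
  by move=> p _; apply: diff_derivable; case: (poly_warp_diff q k E E' p 0).
have := IH ((delta_mx 0 i : V) 0 i2 *:
  (q^`() * (1 + 'X^2) - (2 * k%:R) *: (q * 'X))) k.+1 0.
set f := (X in Ck j U X) => Hf; set g := (X in Ck j U X).
suff -> : g = f by [].
apply/funext => p; rewrite /f /g.
by have [_ ->] := poly_warp_diff q k E E' p (delta_mx 0 i);
  rewrite addr0 hornerZ mulrA.
Qed.

Lemma metric_mx_Coo (U : set V) : Coo U (fun p : V => metric_mx (p 0 i2)).
Proof.
have := @poly_warp_Coo U 1 1 torus_block line_block.
by congr (Coo U _); apply/funext => p; rewrite hornerC mul1r expr1.
Qed.

Definition torus_line_manifold : manifold R :=
  quotient_manifold (@torus_line R) (isT : (0 < 3)%N).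

(** The translations preserve the height. *)
Lemma coord_height (c : V) (x : orbit_space (@torus_line R)) :
  chart_dom c x -> coord c x 0 i2 = lift x 0 i2.
Proof.
move=> /coordP[_ px].
have := lift_proj (@torus_line R) (coord c x); rewrite px => -[w [w2 _] ->].
by rewrite mxE w2 addr0.
Qed.

Definition torus_line_riemannian : riemannian_manifold R.
Proof.
refine (@RiemannianManifold R torus_line_manifold
  (fun _ p => metric_mx (p 0 i2)) (fun i => @metric_mx_Coo _) _ _ _).
- by move=> i x _; exact: metric_mx_sym.
- by move=> i x _ v; exact: metric_mx_pos.
- move=> i j x xi xj u v D.
  rewrite /D (transition_diff_id xi xj) /=.
  by rewrite (coord_height xi) (coord_height xj).
Defined.

End Metric.

(** * Antiderivatives and locally constant functions on the line *)

Section RealLine.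
Context {R : realType}.
Implicit Types (f g S : R -> R).

(** The interval ]-1, 2[ is a neighbourhood of the domain [0, 1] of the paths
    whose length is measured, which gives derivatives at both ends of it. *)
Lemma continuous_antiderivative f : continuous f ->
  exists S, forall t : R, -1 < t -> t < 2 -> is_derive t (1 : R) S (f t).
Proof.
move=> cf.
exists (fun x => \int[lebesgue_measure]_(t in `[(-1), x]) (f t))%R => t t0 t1.
have fi : lebesgue_measure.-integrable `[(-1) : R, 2] (EFin \o f).
  apply: continuous_compact_integrable; first exact: segment_compact.
  exact: continuous_subspaceT.
have [dS dSE] := continuous_FTC1_closed t1 fi t0 (cf t).
by apply: DeriveDef => //; rewrite -derive1E.
Qed.

Lemma derive_le_increment f S (df dS : R -> R) k a b : a <= b ->
  (forall t : R, a <= t <= b -> is_derive t (1 : R) f (df t)) ->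
  (forall t : R, a <= t <= b -> is_derive t (1 : R) S (dS t)) ->
  (forall t : R, a <= t <= b -> df t <= k * dS t) ->
  f b - f a <= k * (S b - S a).
Proof.
rewrite le_eqVlt => /predU1P[<- _ _ _|ab fd Sd le_d].
  by rewrite !subrr mulr0.
pose g : R -> R := (k \*: S - f)%R.
have gd (t : R) : a <= t <= b -> is_derive t (1 : R) g (k *: dS t - df t).
  move=> tab; have := fd t tab; have := Sd t tab => dSt dft.
  exact: is_deriveB.
have [| |c cab] := @MVT R g (fun t => k *: dS t - df t) a b ab.
- by move=> t /subset_itv_oo_cc; rewrite in_itv/= => /gd.
- by apply: derivable_within_continuous => t; rewrite in_itv/= => /gd [].
move: (subset_itv_oo_cc cab); rewrite in_itv/= => /le_d le_c.
rewrite /g /= => e.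
have : 0 <= (k *: dS c - df c) * (b - a).
  by rewrite mulr_ge0// subr_ge0// ltW.
rewrite -e -[X in 0 <= X]/((k * S b - f b) - (k * S a - f a)); lra.
Qed.

Lemma derive_norm_le_increment f S (df dS : R -> R) k a b : a <= b ->
  (forall t : R, a <= t <= b -> is_derive t (1 : R) f (df t)) ->
  (forall t : R, a <= t <= b -> is_derive t (1 : R) S (dS t)) ->
  (forall t : R, a <= t <= b -> `|df t| <= k * dS t) ->
  `|f b - f a| <= k * (S b - S a).
Proof.
move=> ab fd Sd le_d; rewrite ler_norml; apply/andP; split; last first.
  apply: (derive_le_increment ab fd Sd) => t /le_d.
  exact: le_trans (ler_norm _).
have Nfd (t : R) : a <= t <= b -> is_derive t (1 : R) (- f)%R (- df t).
  by move=> /fd ?; exact: is_deriveN.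
have := derive_le_increment (k := k) ab Nfd Sd.
rewrite !fctE => H; suff /H : forall t : R, a <= t <= b -> - df t <= k * dS t.
  by lra.
by move=> t /le_d; apply: le_trans; rewrite -normrN ler_norm.
Qed.

Lemma derive0_near_cst f (t : R) : (\forall s \near t, is_derive s (1 : R) f 0) ->
  \forall s \near t, f s = f t.
Proof.
move=> /nbhs_ballP[e /= e0 He]; apply/nbhs_ballP; exists e => //= s ets.
have H a b : a <= b -> `|t - a| < e -> `|t - b| < e -> f b = f a.
  move=> ab ta tb; apply/eqP; rewrite -subr_eq0 -normr_le0.
  have Hd (u : R) : a <= u <= b -> is_derive u (1 : R) f 0.
    move=> /andP[au ub]; apply: He; rewrite -ball_normE /ball_ /=.
    move: ta tb; rewrite !ltr_norml => /andP[ta1 ta2] /andP[tb1 tb2].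
    by apply/andP; split; lra.
  have := @derive_norm_le_increment f f (fun=> 0) (fun=> 0) 0 a b ab Hd Hd.
  by rewrite !mul0r; apply => u _; rewrite normr0.
rewrite -ball_normE /ball_ /= in ets.
case: (leP s t) => [st|/ltW ts]; last by apply: H; rewrite ?subrr ?normr0.
by apply/esym; apply: H; rewrite ?subrr ?normr0.
Qed.

(** The level sets of a locally constant function are open and closed. *)
Lemma locally_cst_itv (T : Type) (f : R -> T) (a b : R) :
  (forall t, a < t -> t < b -> \forall s \near t, f s = f t) ->
  forall s t, a < s < b -> a < t < b -> f s = f t.
Proof.
move=> f_loc s t sab tab.
have : connected `]a, b[%classic by apply/connected_intervalP; exact: interval_is_interval.
move=> /(_ [set u | `]a, b[%classic u /\ f u = f t]) H.
suff E : [set u | `]a, b[%classic u /\ f u = f t] = `]a, b[%classic.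
  have : `]a, b[%classic s by rewrite /= in_itv.
  by rewrite -E => -[].
apply: H.
- by exists t; rewrite /= in_itv.
- exists (interior [set u | f u = f t]); first exact: open_interior.
  apply/seteqP; split => u /= [uab].
    move=> fut; split => //.
    move: (uab); rewrite in_itv => /andP[au ub].
    by apply: filterS (f_loc u au ub) => v vu; rewrite /= vu.
  by move=> /nbhs_singleton.
- exists (~` interior [set u | f u <> f t]).
    by apply: open_closedC; exact: open_interior.
  apply/seteqP; split => u /= [uab].
    by move=> fut; split => // /nbhs_singleton.
  move=> Hu; split => //; apply: contrapT => fut; apply: Hu.
  move: (uab); rewrite in_itv => /andP[au ub].
  by apply: filterS (f_loc u au ub) => v vu; rewrite /= vu.
Qed.

End RealLine.

(** * Lifting curves *)

Section CurveLifting.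
Context {R : realType} {m : nat} (G : translations R m) (m_gt0 : (0 < m)%N).
Local Notation V := 'rV[R]_m.
Local Notation M := (quotient_manifold G m_gt0).
Local Notation proj := (@proj R m G).
Local Notation coord := (@coord R m G).
Implicit Types (c : R -> M) (x : M) (i j : V).

Lemma chart_dom_near i x : chart_dom i x -> \forall y \near x, chart_dom i y.
Proof. by move=> xi; apply: open_nbhs_nbhs; split => //; exact: chart_dom_open. Qed.

Lemma coord_change_near i j x : chart_dom i x -> chart_dom j x ->
  exists v, \forall y \near x, coord j y = coord i y + v.
Proof.
move=> xi xj; have [_ px] := coordP xi.
have [|v _ Hv] := @coord_near R m G j (coord i x); first by rewrite px.
exists v; have H : \forall y \near x, coord j (proj (coord i y)) = coord i y + v.
  exact: (coord_continuous_at xi Hv).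
have Hi := chart_dom_near xi.
by apply: filterS2 H Hi => y <- /coordP[_ ->].
Qed.

(** Coordinate changes have differential the identity, so that the velocity
    can be read in any chart. *)
Lemma velocity_chart c (t : R) i : C1_curve c -> chart_dom i (c t) ->
  velocity c t = derive1 (coord i \o c) t.
Proof.
move=> [cc cd] ci; rewrite /velocity /= !derive1E.
have [v Hv] := coord_change_near ci (chart_dom_lift (c t)).
have [dci _] := cd i t ci.
have Hv' : \forall s \near t,
    (coord (lift (c t)) \o c) s = (coord i \o c) s + v by exact: (cc t _ Hv).
rewrite (near_eq_derive _ Hv').
have [_ e] := is_deriveD (derivableP dci) (is_derive_cst v t (1 : R)).
by rewrite [LHS]e addr0.
Qed.

Lemma velocity_continuous c : C1_curve c -> continuous (velocity c : R -> V).
Proof.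
move=> cC t; have [cc cd] := cC.
have [_ dc] := cd _ _ (chart_dom_lift (c t)).
have H : \forall s \near t, chart_dom (lift (c t)) (c s).
  exact: (cc t _ (chart_dom_near (chart_dom_lift (c t)))).
have E : \forall s \near t, derive1 (coord (lift (c t)) \o c) s = velocity c s.
  by apply: filterS H => s cs; rewrite (velocity_chart cC cs).
have dc' : derive1 (coord (lift (c t)) \o c) s @[s --> t] --> velocity c t.
  by rewrite -(nbhs_singleton E); exact: dc.
exact: cvg_trans (near_eq_cvg E) dc'.
Qed.

Lemma is_derive_chart c (t : R) i (k : 'I_m) : C1_curve c -> chart_dom i (c t) ->
  is_derive t (1 : R) (fun s => coord i (c s) 0 k) (velocity c t 0 k).
Proof.
move=> cC ci; have [cc cd] := cC; have [dci _] := cd i t ci.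
rewrite (velocity_chart cC ci) derive1E derive_mx// mxE.
apply: DeriveDef => //.
by move/derivable_mxP : dci => /(_ 0 k).
Qed.

(** Integrating the velocity gives the lift: in a chart, both have the same
    derivative, so that their difference is locally constant modulo G. *)
Lemma curve_lift c (p : V) : C1_curve c -> proj p = c 0 ->
  exists q : R -> V, [/\ q 0 = p,
    forall t : R, -1 < t -> t < 2 -> proj (q t) = c t &
    forall (t : R) k, -1 < t -> t < 2 ->
      is_derive t (1 : R) (fun s => q s 0 k) (velocity c t 0 k)].
Proof.
move=> cC p0; have [cc cd] := cC.
have vk k : continuous (fun t : R => velocity c t 0 k).
  move=> t; apply: (@continuous_comp _ _ _ (velocity c : R -> V) (fun v : V => v 0 k)).
    exact: velocity_continuous.
  exact: coord_continuous.
have /choice[g Hg] k := continuous_antiderivative (vk k).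
pose q t : V := \row_k (g k t - g k 0 + p 0 k).
have qd (t : R) k : -1 < t -> t < 2 ->
    is_derive t (1 : R) (fun s => q s 0 k) (velocity c t 0 k).
  move=> t0 t1; under eq_fun do rewrite mxE.
  have Hgt := Hg k t t0 t1.
  by apply: is_derive_eq; rewrite subr0 addr0.
exists q; split => //.
  by apply/rowP => k; rewrite mxE subrr add0r.
  (* The difference between the curve and the projection of its candidate lift,
     as an element of the quotient group. *)
pose h t := proj (lift (c t) - q t).
have hE i t : chart_dom i (c t) -> h t = proj (coord i (c t) - q t).
  move=> /coordP[_ ci]; apply/projP; rewrite opprB addrA subrK.
  by apply/projP; rewrite liftK ci.
have h_loc (t : R) : -1 < t -> t < 2 -> \forall s \near t, h s = h t.
  move=> t0 t1.
  pose i := lift (c t); have ci : chart_dom i (c t) := chart_dom_lift (c t).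
  have Hi : \forall s \near t, chart_dom i (c s) := cc t _ (chart_dom_near ci).
  have Ht0 : \forall s \near t, -1 < s by exact: lt_nbhsr.
  have Ht1 : \forall s \near t, s < 2 by exact: lt_nbhsl.
  have Hk k : \forall s \near t, (coord i (c s) 0 k - q s 0 k) =
      (coord i (c t) 0 k - q t 0 k).
    apply: (@derive0_near_cst _ (fun s => coord i (c s) 0 k - q s 0 k)).
    near=> s.
    have si : chart_dom i (c s) by near: s.
    have s0 : -1 < s by near: s.
    have s1 : s < 2 by near: s.
    have d1 := is_derive_chart k cC si.
    have d2 := qd s k s0 s1.
    by apply: is_derive_eq; rewrite subrr.
  have {}Hk : \forall s \near t, forall k, (coord i (c s) 0 k - q s 0 k) =
      (coord i (c t) 0 k - q t 0 k).
    exact: (@filter_forall _ _ (fun k s => coord i (c s) 0 k - q s 0 k =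
      coord i (c t) 0 k - q t 0 k) (nbhs t) _ Hk).
  apply: filterS2 Hi Hk => s si Hk.
  rewrite (hE i s)// (hE i t)//; congr (proj _).
  by apply/rowP => k; move: (Hk k); rewrite !mxE.
move=> t t0 t1.
have : h t = h 0 by apply: (@locally_cst_itv R _ h (-1) 2) => //; apply/andP; split => //; lra.
have -> : h 0 = proj 0.
  apply/projP; rewrite subr0; apply/projP; rewrite liftK -p0; congr (proj _).
  by apply/rowP => k; rewrite mxE subrr add0r.
by move=> /projP; rewrite subr0 => /projP; rewrite liftK.
Unshelve. all: by end_near. Qed.

(** ** Straight segments *)

Definition segment (p v : V) : R -> M := fun t => proj (p + t *: v).

Lemma line_is_derive (p v : V) (t : R) :
  is_derive t (1 : R) (fun t : R => p + t *: v) v.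
Proof.
have dl : is_derive t (1 : R) (fun t : R => t *: v) v.
  have df : differentiable (fun t : R => t *: v) t.
    by apply: (@differentiableZl _ _ _ (fun t : R => t)); exact: ex_diff.
  apply: DeriveDef; first exact: diff_derivable.
  rewrite deriveE// (@diffZl _ _ _ (fun t : R => t))//.
  by rewrite diff_val scale1r.
by apply: is_derive_eq; rewrite add0r.
Qed.

Lemma line_continuous (p v : V) (t : R) :
  {for t, continuous (fun t : R => p + t *: v)}.
Proof.
 apply: differentiable_continuous; apply/derivable1_diffP.
by case: (line_is_derive p v t).
Qed.

Lemma segment_continuous p v : continuous (segment p v).
Proof.
move=> t; apply: (@continuous_comp _ _ _ (fun t : R => p + t *: v) proj).
  exact: line_continuous.
exact: proj_continuous.
Qed.

Lemma segment_chart p v i (t : R) : chart_dom i (segment p v t) ->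
  is_derive t (1 : R) (coord i \o segment p v) v.
Proof.
move=> ti; have [w _ Hw] := coord_near ti.
have Hw' : \forall s \near t,
    coord i (proj (p + s *: v)) = p + s *: v + w.
  exact: (line_continuous (t := t) Hw).
have dl := line_is_derive p v t.
have dw : is_derive t (1 : R) (fun t : R => p + t *: v + w) v.
  by apply: is_derive_eq; rewrite addr0.
by apply: (near_eq_is_derive _ dw); apply: filterS Hw' => s /= ->.
Qed.

Lemma segment_C1 p v : C1_curve (segment p v).
Proof.
split; first exact: segment_continuous.
move=> i t ti; split; first by case: (segment_chart ti).
have H : \forall s \near t, chart_dom i (segment p v s).
  exact: (segment_continuous (chart_dom_near ti)).
have E : \forall s \near t, v = derive1 (coord i \o segment p v) s.
  apply: filterS H => s si; rewrite derive1E.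
  by case: (segment_chart si) => _ ->.
have vE : v @[s --> t] --> derive1 (coord i \o segment p v) t.
  by rewrite -(nbhs_singleton E); exact: cvg_cst.
exact: cvg_trans (near_eq_cvg E) vE.
Qed.

Lemma segment_velocity p v t : velocity (segment p v) t = v.
Proof.
rewrite /velocity /= derive1E.
by case: (segment_chart (chart_dom_lift (segment p v t))).
Qed.

End CurveLifting.

(** * Comparison of the Riemannian distance with coordinates *)

Section Distance.
Context {R : realType}.
Local Notation V := 'rV[R]_3.
Local Notation G := (@torus_line R).
Local Notation M := (@torus_line_riemannian R).
Local Notation proj := (@proj R 3 G).
Implicit Types (p q v : V) (x y : M) (c : R -> M).

Definition height (x : M) : R := lift x 0 i2.

Lemma height_proj p : height (proj p) = p 0 i2.
Proof. by rewrite /height; have [v [v2 _] ->] := lift_proj G p; rewrite mxE v2 addr0. Qed.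

Lemma height_continuous : continuous height.
Proof.
apply/(@quotient_continuous _ _ _ height).
have -> : height \o proj = (fun p : V => p 0 i2).
  by apply/funext => p; exact: height_proj.
exact: coord_continuous.
Qed.

Lemma metricE x u v : metric x u v =
  warp (height x) * (u 0 i0 * v 0 i0 + u 0 i1 * v 0 i1) + u 0 i2 * v 0 i2.
Proof. by rewrite /metric /= coord_lift metric_mx_form. Qed.

Lemma tnormE x v : tnorm x v =
  Num.sqrt (warp (height x) * (v 0 i0 ^+ 2 + v 0 i1 ^+ 2) + v 0 i2 ^+ 2).
Proof. by rewrite /tnorm metricE -!expr2. Qed.

(** The weight 1 + |t| is comparable to the inverse of the size of the torus,
    and is easier to control along a path. *)
Lemma warp_lower (t : R) : 1 <= (1 + `|t|) ^+ 2 * warp t.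
Proof.
have d0 := warp_den_gt0 t; rewrite -ler_pdivrMr ?warp_gt0// /warp invrK mul1r.
by rewrite sqrrD expr1n mul1r real_normK ?num_real// lerD2r lerDl mulrn_wge0.
Qed.

Lemma warp_upper (t : R) : (1 + `|t|) ^+ 2 * warp t <= 4.
Proof.
have d0 := warp_den_gt0 t; rewrite ler_pdivrMr//.
have := sqr_ge0 (1 - `|t|); rewrite sqrrB sqrrD !expr1n mul1r real_normK ?num_real//.
lra.
Qed.

Lemma tnorm_ge0 x v : 0 <= tnorm x v.
Proof. exact: sqrtr_ge0. Qed.

Lemma tnorm_ge_line x v : `|v 0 i2| <= tnorm x v.
Proof.
rewrite tnormE -sqrtr_sqr ler_wsqrtr// lerDr mulr_ge0 ?addr_ge0 ?sqr_ge0//.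
exact/ltW/warp_gt0.
Qed.

Lemma tnorm_ge_torus x v k : k != i2 ->
  `|v 0 k| <= (1 + `|height x|) * tnorm x v.
Proof.
move=> k2; have h0 : 0 <= 1 + `|height x| by rewrite addr_ge0.
have := warp_lower (height x); rewrite tnormE.
move: (1 + `|height x|) h0 => a a0 wa.
rewrite -{1}(ger0_norm a0) -!sqrtr_sqr -sqrtrM ?sqr_ge0//.
apply: ler_wsqrtr.
have s0 := sqr_ge0 (v 0 i0); have s1 := sqr_ge0 (v 0 i1).
have s2 := sqr_ge0 (v 0 i2).
apply: (@le_trans _ _ (a ^+ 2 * warp (height x) * (v 0 i0 ^+ 2 + v 0 i1 ^+ 2))).
  apply: (@le_trans _ _ (v 0 i0 ^+ 2 + v 0 i1 ^+ 2)).
    by move: k k2; apply: forall_ord3 => // _; rewrite ?lerDl ?lerDr.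
  by rewrite ler_peMl ?addr_ge0.
by rewrite -mulrA ler_wpM2l ?sqr_ge0// lerDl sqr_ge0.
Qed.

Lemma tnorm_le_torus x v : v 0 i2 = 0 ->
  tnorm x v <= 2 * (`|v 0 i0| + `|v 0 i1|) / (1 + `|height x|).
Proof.
move=> v2; have h0 : 0 < 1 + `|height x| by rewrite ltr_wpDr.
have := warp_upper (height x); rewrite tnormE v2 expr0n addr0.
have w0 := warp_gt0 (height x).
move: (1 + `|height x|) h0 => a a0 wa.
rewrite ler_pdivlMr//.
rewrite -(real_normK (num_real (v 0 i0))) -(real_normK (num_real (v 0 i1))).
have := normr_ge0 (v 0 i0); have := normr_ge0 (v 0 i1).
move: `|v 0 i0| `|v 0 i1| => b c c0 b0.
have n0 : 0 <= 2 * (b + c) by rewrite mulr_ge0// addr_ge0.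
rewrite -(ger0_norm n0) -{1}(ger0_norm (ltW a0)) -!sqrtr_sqr -sqrtrM; last first.
  by rewrite mulr_ge0 ?addr_ge0 ?sqr_ge0// ltW.
apply: ler_wsqrtr.
apply: (@le_trans _ _ (4 * (b ^+ 2 + c ^+ 2))); last by nra.
rewrite mulrAC ler_wpM2r ?addr_ge0 ?sqr_ge0//.
by rewrite mulrC.
Qed.

Lemma tnorm_line x v : v 0 i0 = 0 -> v 0 i1 = 0 -> tnorm x v = `|v 0 i2|.
Proof. by move=> v0 v1; rewrite tnormE v0 v1 expr0n addr0 mulr0 add0r sqrtr_sqr. Qed.

Lemma speed_continuous c : C1_curve c ->
  continuous (fun t : R => tnorm (c t) (velocity c t)).
Proof.
move=> cC; have [cc _] := cC.
have vk k : continuous (fun t : R => velocity c t 0 k).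
  move=> t; apply: (@continuous_comp _ _ _ (velocity c : R -> V) (fun v : V => v 0 k)).
    exact: (@velocity_continuous R 3 G isT c cC).
  exact: coord_continuous.
have hk : continuous (height \o c).
  by move=> t; apply: continuous_comp; [exact: cc|exact: height_continuous].
have sqr_continuous (f : R -> R) : continuous f -> continuous (fun t => f t ^+ 2).
  by move=> cf t; under eq_fun do rewrite expr2; apply: cvgM; exact: cf.
have wk : continuous (fun t => warp ((height \o c) t)).
  move=> t; apply: (@cvgV _ _ _ _ (fun t => 1 + (height \o c) t ^+ 2)).
    by rewrite gt_eqF// warp_den_gt0.
  by apply: cvgD; [exact: cvg_cst|exact: sqr_continuous].
under eq_fun do rewrite tnormE.
move=> t; apply: continuous_comp; last exact: sqrt_continuous.
apply: cvgD; last by apply: sqr_continuous; exact: vk.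
apply: cvgM; first exact: wk.
by apply: cvgD; apply: sqr_continuous; exact: vk.
Qed.

Lemma curve_length_antiderivative c : C1_curve c -> exists S : R -> R,
  curve_length c = (S 1 - S 0)%:E /\
  forall t : R, -1 < t -> t < 2 ->
    is_derive t (1 : R) S (tnorm (c t) (velocity c t)).
Proof.
move=> cC; have [S HS] := continuous_antiderivative (speed_continuous cC).
exists S; split => //.
have S01 (t : R) : 0 <= t <= 1 -> is_derive t (1 : R) S (tnorm (c t) (velocity c t)).
  by move=> /andP[t0 t1]; apply: HS; lra.
have Sc (t : R) : 0 <= t <= 1 -> S x @[x --> t] --> S t.
  move=> /S01[dS _]; apply: differentiable_continuous.
  exact/derivable1_diffP.
rewrite /curve_length (@continuous_FTC2 _ (fun t => tnorm (c t) (velocity c t)) S)//.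
- by apply: continuous_subspaceT; exact: speed_continuous.
- split.
  + by move=> t; rewrite in_itv/= => /andP[t0 t1]; case: (S01 t); rewrite ?ltW.
  + by apply: cvg_at_right_filter; apply: Sc; rewrite lexx ler01.
  + by apply: cvg_at_left_filter; apply: Sc; rewrite lexx ler01.
- move=> t; rewrite in_itv/= => /andP[t0 t1]; rewrite derive1E.
  by case: (S01 t); rewrite ?ltW.
Qed.

(** The length bounds the variation of the height, hence from below the size
    of the torus along the curve, hence the displacement along the torus. *)
Lemma curve_displacement c p : C1_curve c -> proj p = c 0 ->
  exists (r : R) q, [/\ curve_length c = r%:E, 0 <= r, proj q = c 1,
    `|q 0 i2 - p 0 i2| <= r &
    forall k, k != i2 -> `|q 0 k - p 0 k| <= (1 + `|p 0 i2| + r) * r].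
Proof.
move=> cC p0.
have [q [q0 qc qd]] := @curve_lift R 3 G isT c p cC p0.
have [S [SE Sd]] := curve_length_antiderivative cC.
have in12 (a t : R) : 0 <= a <= 1 -> 0 <= t <= a -> -1 < t /\ t < 2.
  by move=> /andP[a0 a1] /andP[t0 t1]; split; lra.
have S_incr (a b : R) : 0 <= a -> a <= b -> b <= 1 -> S a <= S b.
  move=> a0 ab b1.
  have Sd' (t : R) : a <= t <= b -> is_derive t (1 : R) S (tnorm (c t) (velocity c t)).
    by move=> /andP[t0 t1]; apply: Sd; lra.
  have d0 (t : R) : a <= t <= b -> is_derive t (1 : R) (cst 0 : R -> R) 0.
    by move=> _; exact: is_derive_cst.
  have := derive_le_increment (k := 1) ab d0 Sd'.
  rewrite mul1r subrr subr_ge0; apply => t _.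
  by rewrite mul1r tnorm_ge0.
have H2 (a : R) : 0 <= a <= 1 -> `|q a 0 i2 - p 0 i2| <= S a - S 0.
  move=> a01; have /andP[a0 a1] := a01.
  rewrite -q0 -[S a - S 0]mul1r.
  apply: (@derive_norm_le_increment R (fun s => q s 0 i2) S
    (fun t => velocity c t 0 i2) (fun t => tnorm (c t) (velocity c t))) => //.
  - by move=> t /(in12 _ _ a01)[t0 t1]; exact: qd.
  - by move=> t /(in12 _ _ a01)[t0 t1]; exact: Sd.
  - by move=> t _; rewrite mul1r tnorm_ge_line.
have r0 : 0 <= S 1 - S 0 by rewrite subr_ge0 S_incr.
exists (S 1 - S 0), (q 1); split => //.
- by rewrite qc//; lra.
- by apply: H2; rewrite ler01 lexx.
move=> k k2; rewrite -q0.
apply: (@derive_norm_le_increment R (fun s => q s 0 k) S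
    (fun t => velocity c t 0 k) (fun t => tnorm (c t) (velocity c t))) => //.
- by move=> t t01; apply: qd; move/andP: t01 => [? ?]; lra.
- by move=> t t01; apply: Sd; move/andP: t01 => [? ?]; lra.
move=> t t01; have /andP[t0 t1] := t01.
apply: le_trans (tnorm_ge_torus (c t) _ k2) _.
rewrite ler_wpM2r ?tnorm_ge0// -addrA lerD2l q0.
have -> : height (c t) = q t 0 i2 by rewrite -qc ?height_proj//; lra.
have := ler_normD (q t 0 i2 - p 0 i2) (p 0 i2); rewrite subrK.
have := H2 t t01; have := S_incr t 1 t0 t1 (lexx 1); lra.
Qed.

(** The bound (1 + |t| + r) r is superadditive along concatenations, which
    start their second piece at a height at most |t| + r. *)
Lemma path_displacement x y l : path_of_length x y l ->
  exists2 r : R, l = r%:E /\ 0 <= r & forall p, proj p = x ->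
  exists q, [/\ proj q = y, `|q 0 i2 - p 0 i2| <= r &
    forall k, k != i2 -> `|q 0 k - p 0 k| <= (1 + `|p 0 i2| + r) * r].
Proof.
elim=> [{}x|c {}y {}l cC _ [r [-> r0] IH]].
  exists 0 => // p px; exists p; split => // [|k _].
    by rewrite subrr normr0.
  by rewrite subrr normr0 mulr0.
have [r1 [q1 [E1 r10 _ _ _]]] := curve_displacement cC (liftK (c 0)).
exists (r1 + r); first by rewrite E1 EFinD addr_ge0.
move=> p pc; have [r1' [q [E1' _ qc q2 qk]]] := curve_displacement cC pc.
have e1 : r1' = r1 by apply: EFin_inj; rewrite -E1 -E1'.
rewrite {}e1 in q2 qk.
have [q' [q'y q'2 q'k]] := IH q qc.
exists q'; split => // [|k k2].
  rewrite (le_trans (ler_distD (q 0 i2) _ _))// addrC lerD//.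
rewrite (le_trans (ler_distD (q 0 k) _ _))//.
have h : `|q 0 i2| <= `|p 0 i2| + r1.
  have := ler_normD (q 0 i2 - p 0 i2) (p 0 i2); rewrite subrK; lra.
have := qk k k2; have := q'k k k2; have := normr_ge0 (p 0 i2).
set a := `|_ - _|; set b := `|_ - _|; set P := `|p 0 i2| => P0 Ha Hb.
have : a <= (1 + (P + r1) + r) * r.
  by apply: (le_trans Ha); rewrite ler_wpM2r// lerD2r lerD2l.
nra.
Qed.

Lemma rdist_displacement x y (d e : R) p : (rdist x y <= d%:E)%E -> d < e ->
  proj p = x -> exists q, [/\ proj q = y, `|q 0 i2 - p 0 i2| <= e &
    forall k, k != i2 -> `|q 0 k - p 0 k| <= (1 + `|p 0 i2| + e) * e].
Proof.
move=> xyd de px.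
have : (rdist x y < e%:E)%E by rewrite (le_lt_trans xyd)// lte_fin.
move=> /ereal_inf_lt[l /= /path_displacement[r [-> r0] H]].
rewrite lte_fin => /ltW re; have [q [qy q2 qk]] := H p px.
exists q; split => //; first exact: le_trans re.
move=> k k2; rewrite (le_trans (qk k k2))//.
have P0 := normr_ge0 (p 0 i2).
apply: ler_pM => //; first by rewrite !addr_ge0.
by rewrite lerD2l.
Qed.

(** ** Upper bounds *)

Lemma path_of_length_trans x y z l l' : path_of_length x y l ->
  path_of_length y z l' -> path_of_length x z (l + l')%E.
Proof.
move=> xy yz; elim: xy yz => [{}x|c {}y {}l cC _ IH] yz; first by rewrite add0e.
by rewrite -addeA; apply: path_cons => //; exact: IH.
Qed.

Lemma rdist_triangle x y z (a b : R) : (rdist x y < a%:E)%E ->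
  (rdist y z < b%:E)%E -> (rdist x z < (a + b)%:E)%E.
Proof.
move=> /ereal_inf_lt[l /= xyl la] /ereal_inf_lt[l' /= yzl lb].
apply: (@le_lt_trans _ _ (l + l')%E).
  by apply: ereal_inf_lbound; exact: path_of_length_trans yzl.
by rewrite EFinD; exact: lteD.
Qed.

Local Notation segment := (@segment R 3 G isT).

Lemma segment_path p v (d : R) :
  (forall t : R, tnorm (segment p v t : M) v = d) ->
  path_of_length (proj p : M) (proj (p + v) : M) d%:E.
Proof.
move=> td.
have := @path_cons R M (segment p v) (proj (p + v)) 0%E
  (@segment_C1 R 3 G isT p v).
rewrite /segment scale0r addr0 scale1r => /(_ (path_nil _)).
congr (path_of_length _ _ _); rewrite adde0 /curve_length.
under eq_integral => t _ do
  rewrite (@segment_velocity R 3 G isT p v t) td.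
rewrite integral_cst//= lebesgue_measure_itv/= lte_fin ltr01.
by rewrite sube0 mule1.
Qed.

(** The path follows the torus first, at constant height, then the line. *)
Lemma rdist_le p v : (rdist (proj p : M) (proj (p + v) : M) <=
  (`|v 0 i2| + 2 * (`|v 0 i0| + `|v 0 i1|) / (1 + `|p 0 i2|))%:E)%E.
Proof.
pose vt : V := vec3 (v 0 i0) (v 0 i1) 0; pose vl : V := vec3 0 0 (v 0 i2).
have vE : p + v = p + vt + vl.
  by rewrite -addrA; congr (_ + _); apply: vec3P; rewrite mxE !vec3E ?addr0 ?add0r.
have path_t : path_of_length (proj p : M) (proj (p + vt) : M) (tnorm (proj p : M) vt)%:E.
  apply: segment_path => t; rewrite !tnormE /segment !height_proj.
  by rewrite !mxE /= mulr0 addr0.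
have path_l : path_of_length (proj (p + vt) : M) (proj (p + vt + vl) : M) (`|v 0 i2|)%:E.
  by apply: segment_path => t; rewrite tnorm_line !vec3E.
rewrite vE; apply: (@le_trans _ _ (tnorm (proj p : M) vt + `|v 0 i2|)%:E).
  by apply: ereal_inf_lbound; rewrite EFinD; exact: path_of_length_trans path_l.
rewrite lee_fin addrC lerD2l.
have := @tnorm_le_torus (proj p) vt; rewrite !vec3E height_proj; exact.
Qed.

End Distance.

(** * Bounded curvature *)

Section Curvature.
Context {R : realType}.
Local Notation V := 'rV[R]_3.
Local Notation M := (@torus_line_riemannian R).
Implicit Types (t : R) (p : V) (i j k l : 'I_3).

Lemma invmx_metric_mx t : invmx (metric_mx t) =
  \matrix_(i, j) ((i == j)%:R * (if i == i2 then 1 else 1 + t ^+ 2)).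
Proof.
set B := (X in _ = X).
have d0 : 1 + t ^+ 2 != 0 by rewrite gt_eqF ?warp_den_gt0.
have AB : metric_mx t *m B = 1%:M.
  apply/matrixP => i j; rewrite mxE sum_ord3 !metric_mxE !mxE.
  by move: i j; do 2 apply: forall_ord3; rewrite /= /warp; field.
have [Au _] := mulmx1_unit AB.
by rewrite -[LHS]mulmx1 -AB mulKmx.
Qed.

(** The Christoffel symbols of the warped metric, as functions of the height. *)
Definition christoffel_height l i j t : R :=
  if l == i2 then ((i == j) && (i != i2))%:R * (t * warp t ^+ 2)
  else ((i == l) && (j == i2) || (j == l) && (i == i2))%:R * - (t * warp t).

Definition christoffel_height' l i j t : R :=
  if l == i2 then
    ((i == j) && (i != i2))%:R * (warp t ^+ 2 - 4 * t ^+ 2 * warp t ^+ 3)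
  else ((i == l) && (j == i2) || (j == l) && (i == i2))%:R *
    (2 * t ^+ 2 * warp t ^+ 2 - warp t).

Lemma partial_height (f : R -> R) (df : R) p i :
  is_derive (p 0 i2) (1 : R) f df ->
  @partial R M i (fun q : V => f (q 0 i2)) p = (i == i2)%:R * df.
Proof.
move=> /(derive_height (delta_mx 0 i)) [_ fE].
by rewrite /partial [LHS]fE mxE eqxx eq_sym.
Qed.

Lemma is_derive_metric_entry i j t :
  is_derive t (1 : R) (fun t => metric_mx t i j)
    (((i == j) && (i != i2))%:R * (- (2 * t) * warp t ^+ 2)).
Proof.
have dw := is_derive_warp t.
under eq_fun do rewrite metric_mxE.
move: i j; do 2 apply: forall_ord3; rewrite /=;
  by apply: is_derive_eq; rewrite /GRing.scale/=; ring.
Qed.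

Lemma christoffelE (c : V) l i j p :
  @christoffel R M c l i j p = christoffel_height l i j (p 0 i2).
Proof.
rewrite /christoffel /gram_entry /= invmx_metric_mx sum_ord3 !mxE.
rewrite !(partial_height _ (is_derive_metric_entry _ _ _)).
have d0 : 1 + (p 0 i2) ^+ 2 != 0 by rewrite gt_eqF ?warp_den_gt0.
rewrite /christoffel_height.
by move: l i j; do 3 apply: forall_ord3; rewrite /= /warp; field.
Qed.

Lemma is_derive_christoffel_height l i j t :
  is_derive t (1 : R) (christoffel_height l i j) (christoffel_height' l i j t).
Proof.
have dw := is_derive_warp t.
have d2 : is_derive t (1 : R) (fun t => t * warp t ^+ 2)
    (warp t ^+ 2 - 4 * t ^+ 2 * warp t ^+ 3).
  under eq_fun do rewrite expr2.
  by apply: is_derive_eq; rewrite /GRing.scale/=; ring.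
have d1 : is_derive t (1 : R) (fun t => - (t * warp t))
    (2 * t ^+ 2 * warp t ^+ 2 - warp t).
  by apply: is_derive_eq; rewrite /GRing.scale/=; ring.
rewrite /christoffel_height /christoffel_height'; case: (l == i2).
  by apply: is_derive_eq.
by apply: is_derive_eq.
Qed.

(** The sectional curvatures of the coordinate planes: - phi'' / phi for the
    planes that contain the line, - (phi' / phi)^2 for the torus, where
    phi = (1 + t^2)^(-1/2). *)
Definition plane_curvature i j t : R :=
  if (i == i2) || (j == i2) then (1 - 2 * t ^+ 2) * warp t ^+ 2
  else - (t ^+ 2 * warp t ^+ 2).

Lemma riemann_coefE (c : V) l i j k p : @riemann_coef R M c l i j k p =
  plane_curvature i j (p 0 i2) *
    (metric_mx (p 0 i2) j k * (i == l)%:R - metric_mx (p 0 i2) i k * (j == l)%:R).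
Proof.
rewrite /riemann_coef.
have cE a b d : @christoffel R M c a b d = (fun q => christoffel_height a b d (q 0 i2)).
  by apply/funext => q; exact: christoffelE.
rewrite sum_ord3 !cE !(partial_height _ (is_derive_christoffel_height _ _ _ _)).
rewrite !metric_mxE /christoffel_height /christoffel_height' /plane_curvature.
move: (p 0 i2) => t.
have d0 : 1 + t ^+ 2 != 0 by rewrite gt_eqF ?warp_den_gt0.
by move: l i j k; do 4 apply: forall_ord3; rewrite /= /warp; field.
Qed.


Lemma riemannE (x : M) (u v w : V) l : riemann x u v w 0 l =
  \sum_(i < 3) \sum_(j < 3) \sum_(k < 3) u 0 i * v 0 j * w 0 k *
    (plane_curvature i j (height x) * (metric_mx (height x) j k * (i == l)%:R -
       metric_mx (height x) i k * (j == l)%:R)).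
Proof.
rewrite /riemann mxE; apply: eq_bigr => i _; apply: eq_bigr => j _.
apply: eq_bigr => k _; congr (_ * _).
by rewrite riemann_coefE /= coord_lift.
Qed.

(** The sectional curvature is the mean of the curvatures of the coordinate
    planes, weighted by the squared areas of the projections of a parallelogram
    on them. *)
Lemma metric_riemannE (x : M) (u v : V) :
  let w := warp (height x) in
  let a i j := (u 0 i * v 0 j - u 0 j * v 0 i) ^+ 2 in
  metric x (riemann x u v v) u =
    plane_curvature i0 i1 (height x) * (w ^+ 2 * a i0 i1) +
    plane_curvature i0 i2 (height x) * (w * (a i0 i2 + a i1 i2)).
Proof.
move=> w a; rewrite metricE !riemannE.
rewrite /a -/w; move: (height x) => t in w *; rewrite {}/w.
rewrite !sum_ord3 !metric_mxE /plane_curvature /=.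
move: (warp t) => W.
move: (u 0 i0) (u 0 i1) (u 0 i2) (v 0 i0) (v 0 i1) (v 0 i2) => u0 u1 u2 v0 v1 v2.
ring.
Qed.

Lemma gram_detE (x : M) (u v : V) :
  let w := warp (height x) in
  let a i j := (u 0 i * v 0 j - u 0 j * v 0 i) ^+ 2 in
  metric x u u * metric x v v - metric x u v ^+ 2 =
  w ^+ 2 * a i0 i1 + w * (a i0 i2 + a i1 i2).
Proof. by move=> w a; rewrite !metricE /w /a; ring. Qed.

Lemma plane_curvature_bound i j t : `|plane_curvature i j t| <= 2.
Proof.
have d0 := warp_den_gt0 t; have w0 := warp_gt0 t.
have wE : (1 + t ^+ 2) * warp t = 1 by rewrite mulfV ?gt_eqF.
have t0 := sqr_ge0 t.
have w1 : warp t <= 1 by rewrite invf_le1// lerDl.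
have w2 : 0 <= warp t ^+ 2 <= 1 by rewrite sqr_ge0 exprn_ile1// ltW.
have tw : 0 <= t ^+ 2 * warp t ^+ 2 <= 1.
  rewrite mulr_ge0 ?sqr_ge0//=; have -> : t ^+ 2 * warp t ^+ 2 = (1 - warp t) * warp t.
    by rewrite -{1}wE; ring.
  by apply: mulr_ile1; lra.
rewrite /plane_curvature; case: ifP => _; rewrite ler_norml; lra.
Qed.

Lemma torus_line_bounded_sec : bounded_sec M.
Proof.
exists 2 => x u v _; rewrite /sec gram_detE metric_riemannE.
set A := _ ^+ 2 * _; set B := warp _ * _.
have A0 : 0 <= A by rewrite mulr_ge0 ?sqr_ge0.
have B0 : 0 <= B by rewrite mulr_ge0 ?addr_ge0 ?sqr_ge0// ltW ?warp_gt0.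
have := plane_curvature_bound i0 i1 (height x).
have := plane_curvature_bound i0 i2 (height x).
move: (plane_curvature i0 i1 _) (plane_curvature i0 i2 _) => k1 k2 k2B k1B.
move: A B A0 B0 => A B A0 B0.
have [->|AB0] := eqVneq (A + B) 0; first by rewrite invr0 mulr0 normr0.
have AB : 0 < A + B by rewrite lt_neqAle eq_sym AB0 addr_ge0.
rewrite normrM normfV (gtr0_norm AB) ler_pdivrMr//.
rewrite (le_trans (ler_normD _ _))// !normrM (ger0_norm A0) (ger0_norm B0) mulrDr.
by apply: lerD; exact: ler_wpM2r.
Qed.

End Curvature.

(** * Completeness and finite volume *)

Section Completeness.
Context {R : realType}.
Local Notation V := 'rV[R]_3.
Local Notation G := (@torus_line R).
Local Notation M := (@torus_line_riemannian R).
Local Notation proj := (@proj R 3 G).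

Lemma torus_line_connected : connected_manifold M.
Proof. by split; [exists (proj 0)|exact: orbit_space_connected]. Qed.

Lemma bounded_lift (x : M) : exists p : V,
  [/\ proj p = x, `|p 0 i0| <= 3 & `|p 0 i1| <= 3].
Proof.
have [v Gv [v2 [v0 v1]]] := lattice_reduce (lift x 0 i0) (lift x 0 i1).
exists (lift x + v); rewrite !mxE; split => //.
by rewrite -[RHS](liftK x); exact: proj_translate.
Qed.

(** The heights of a Cauchy sequence are bounded, so that its terms lift to a
    compact box. A cluster point of the lifts projects to the limit. *)
Lemma torus_line_complete : complete_manifold M.
Proof.
move=> u Cu.
have /choice[p Hp] n := bounded_lift (u n).
have pu n : proj (p n) = u n by case: (Hp n).
have [N1 HN1] := Cu 1 ltr01.
pose B := `|p N1 0 i2| + 2.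
have p2 n : (N1 <= n)%N -> `|p n 0 i2| <= B.
  move=> n1; have H : (rdist (u N1) (u n) <= 1%:E)%E by rewrite ltW// HN1.
  have [|q [qn q2 _]] := @rdist_displacement R _ _ 1 2 (p N1) H _ (pu N1); first lra.
  have -> : p n 0 i2 = q 0 i2 by rewrite -!height_proj pu qn.
  by have := ler_normD (q 0 i2 - p N1 0 i2) (p N1 0 i2); rewrite subrK /B; lra.
pose box (k : 'I_3) := `[- Num.max B 3, Num.max B 3]%classic : set R.
have cK : compact [set v : V | forall k, box k (v 0 k)].
  by apply: rV_compact => k; exact: segment_compact.
have inK : \forall n \near \oo, [set v : V | forall k, box k (v 0 k)] (p n).
  exists N1 => // n /= n1; rewrite /box.
  have [_ pn0 pn1] := Hp n; have pn2 := p2 n n1.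
  by apply: forall_ord3; rewrite /= in_itv/= -ler_norml le_max ?pn0 ?pn1 ?pn2 ?orbT.
have [z [_ zp]] := cK (p n @[n --> \oo]) _ inK.
exists (proj z) => e e0.
have [N HN] := Cu (e / 2) (divr_gt0 e0 (ltr0n _ 2)).
exists N => n Nn.
have pN : \forall k \near \oo, [set p k | k in [set k | (N <= k)%N]] (p k).
  by exists N => // k Nk; exists k.
have e20 : 0 < e / 20 by rewrite divr_gt0.
  (* A sup-norm displacement of r costs at most 5 r by rdist_le. *)
have [_ [[k Nk <-] [_ zk]]] := zp _ _ pN (nbhsx_ballx z (e / 20) e20).
have zpk j : `|z 0 j - p k 0 j| < e / 20.
  by have := zk 0 j; rewrite -ball_normE.
rewrite [e]splitr; apply: (@rdist_triangle _ _ (u k)); first exact: HN.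
have zE : z = p k + (z - p k) by rewrite addrC subrK.
rewrite -(pu k) [in proj z]zE.
apply: (le_lt_trans (rdist_le _ _)); rewrite lte_fin !mxE.
have := zpk i0; have := zpk i1; have := zpk i2.
move: `|z 0 i0 - _| (normr_ge0 (z 0 i0 - p k 0 i0)) => a a0.
move: `|z 0 i1 - _| (normr_ge0 (z 0 i1 - p k 0 i1)) => b b0.
move: `|z 0 i2 - _| => c Hc Hb Ha.
suff : 2 * (a + b) / (1 + `|p k 0 i2|) <= 2 * (a + b) by lra.
rewrite ler_pdivrMr ?ltr_wpDr//; have := normr_ge0 (p k 0 i2); nra.
Qed.

End Completeness.

Section Volume.
Context {R : realType}.
Local Notation V := 'rV[R]_3.
Local Notation G := (@torus_line R).
Local Notation M := (@torus_line_riemannian R).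
Local Notation proj := (@proj R 3 G).
Local Notation mu := (@lebesgue_measure R).
Local Open Scope ereal_scope.

Lemma integral_warp : \int[mu]_t (warp t)%:E = pi%:E.
Proof.
rewrite ge0_symfun_integralT.
- rewrite -set_itvcy; have := @integral0y_oneDsqr R; rewrite /warp /oneDsqr => ->.
  by rewrite -EFinM; congr EFin; field.
- by move=> t; exact/ltW/warp_gt0.
- exact: continuous_oneDsqrV.
- by move=> t; rewrite /warp /= sqrrN.
Qed.

Lemma det_metric_mx (t : R) : \det (metric_mx t) = (warp t ^+ 2)%R.
Proof.
have -> : metric_mx t = diag_mx (vec3 (warp t) (warp t) 1).
  apply/matrixP => i j; rewrite metric_mxE !mxE.
  by move: i j; do 2 apply: forall_ord3; rewrite /= ?mulr1n ?mulr0n ?mul0r ?mul1r.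
rewrite det_diag !big_ord_recl big_ord0 !mxE /=; ring.
Qed.

(** The point at which the iterated integral evaluates its argument. *)
Definition stacked_row (a b c : R) : V :=
  @row_mx R 1 1 2 (const_mx a)
    (@row_mx R 1 1 1 (const_mx b) (@row_mx R 1 1 0 (const_mx c) 0)).

Lemma stacked_rowE a b c : stacked_row a b c = vec3 a b c.
Proof.
apply: vec3P; rewrite vec3E /stacked_row.
- have -> : i0 = @lshift 1 2 ord0 by exact: val_inj.
  by apply: etrans (row_mxEl _ _ _ _) _; rewrite mxE.
- have -> : i1 = @rshift 1 2 (@lshift 1 1 ord0) by exact: val_inj.
  apply: etrans (row_mxEr _ _ _ _) _; apply: etrans (row_mxEl _ _ _ _) _.
  by rewrite mxE.
- have -> : i2 = @rshift 1 2 (@rshift 1 1 (@lshift 1 0 ord0)) by exact: val_inj.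
  apply: etrans (row_mxEr _ _ _ _) _; apply: etrans (row_mxEr _ _ _ _) _.
  by apply: etrans (row_mxEl _ _ _ _) _; rewrite mxE.
Qed.

Lemma chart_volume_cell (c : V) :
  @chart_volume R M c (chart_dom c) = pi%:E.
Proof.
rewrite /chart_volume [atlas _ @` _]coord_image.
pose I k : set R := `](c 0%R k - 1 / 2)%R, (c 0%R k + 1 / 2)%R[%classic.
have muI k : mu (I k) = 1.
  rewrite lebesgue_measure_itv/= lte_fin ifT; last by lra.
  by rewrite -EFinD; congr EFin; field.
have intI k : \int[mu]_x (\1_(I k) x)%:E = 1.
  rewrite integral_indic//; last exact: measurable_itv.
  by rewrite setIT; exact: muI.
have E (a b t : R) : (\1_[set p : V | cell G (p - c)] (vec3 a b t) *
    Num.sqrt (\det (metric_mx (vec3 a b t 0 i2))) =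
   \1_(I i0) a * (\1_(I i1) b * warp t))%R.
  rewrite det_metric_mx sqrtr_sqr vec3E (ger0_norm (ltW (warp_gt0 t))) mulrA; congr (_ * _)%R.
  rewrite !indicE -natrM mulnb; congr (_%:R); congr nat_of_bool.
  apply/idP/andP; rewrite /I !inE /= /lattice_cell /= !mxE !in_itv/= !ltr_norml.
    by move=> [/andP[? ?] /andP[? ?]]; split; apply/andP; split; lra.
  by move=> [/andP[? ?] /andP[? ?]]; split; apply/andP; split; lra.
have w0 (t : R) : (0 <= warp t)%R by exact/ltW/warp_gt0.
rewrite /=.
transitivity (\int[mu]_a \int[mu]_b ((\1_(I i0) a)%:E * ((\1_(I i1) b)%:E * pi%:E))).
  apply: eq_integral => a _; apply: eq_integral => b _.
  rewrite -integral_warp -!ge0_integralZl_EFin//.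
  - by apply: eq_integral => t _; rewrite -!EFinM; congr EFin; rewrite -[RHS]E -stacked_rowE.
  - by move=> t _; rewrite -EFinM lee_fin mulr_ge0.
  - apply: measurable_funeM; apply/measurable_EFinP.
    by apply: continuous_measurable_fun; exact: continuous_oneDsqrV.
  - by move=> t _; rewrite lee_fin.
  - apply/measurable_EFinP.
    by apply: continuous_measurable_fun; exact: continuous_oneDsqrV.
have pi0 : (0 <= pi :> R)%R by exact: pi_ge0.
have ind0 k (t : R) : 0 <= (\1_(I k) t : R)%:E by rewrite lee_fin.
transitivity (\int[mu]_a ((\1_(I i0) a)%:E * pi%:E)).
  apply: eq_integral => a _.
  rewrite ge0_integralZl_EFin//; last 2 first.
  - by move=> b _; apply: mule_ge0 => //; rewrite lee_fin.
  - apply: emeasurable_funM; last exact: measurable_cst.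
    by apply/measurable_EFinP; exact: measurable_indic (measurable_itv _).
  congr (_ * _); rewrite -[RHS]mul1e -(intI i1); apply: ge0_integralZr => //.
  by apply/measurable_EFinP; exact: measurable_indic (measurable_itv _).
rewrite -[RHS]mul1e -(intI i0); apply: ge0_integralZr => //.
by apply/measurable_EFinP; exact: measurable_indic (measurable_itv _).
Qed.

(** Finitely many chart domains cover M, each of volume pi. *)
Lemma torus_line_finite_volume : finite_volume M.
Proof.
  (* The 13 x 13 grid of step 1/2 in the square [-3, 3]^2, which contains a
     representative of each point of the torus. *)
pose center (k : nat) : V :=
  vec3 (((k %/ 13)%:R - 6) / 2)%R (((k %% 13)%:R - 6) / 2)%R 0.
pose B k : set M := if (k < 169)%N then chart_dom (center k) else set0.
apply: (@le_lt_trans _ _ (\sum_(0 <= k <oo) @chart_volume R M (center k) (B k))).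
  apply: ereal_inf_lbound; exists center, B; split => //.
  - move=> k; apply: sub_sigma_algebra; rewrite /B; case: ifP => _.
      exact: chart_dom_open.
    exact: open0.
  - by move=> k x; rewrite /B; case: ifP => [_ xk|_ []]; first exact: xk.
  - move=> x _; have [p [px p0 p1]] := bounded_lift x.
    have grid (a : R) : (`|a| <= 3)%R -> exists2 j : nat, (j < 13)%N &
        (`|a - (j%:R - 6) / 2| < 1 / 2)%R.
      rewrite ler_norml => /andP[a0 a1].
      have b0 : (0 <= 2 * a + 6)%R by lra.
      have t0 : ((Num.truncn (2 * a + 6))%:R <= 2 * a + 6)%R by rewrite truncn_le.
      exists (Num.truncn (2 * a + 6)).
        rewrite -(ltr_nat R) (le_lt_trans t0)//; lra.
      have := truncnS_gt (2 * a + 6); rewrite -[ltRHS]natr1 => h2.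
      rewrite ltr_norml; apply/andP; split; lra.
    have [j j13 Hj] := grid _ p0; have [k k13 Hk] := grid _ p1.
    exists (j * 13 + k)%N => //.
    rewrite /B ifT; last by lia.
    exists p => //; split; rewrite !mxE /= ?divnMDl// ?(divn_small k13) ?addn0//.
    by rewrite modnMDl modn_small.
rewrite (@lim_near_cst _ _ _ _ _ (\sum_(0 <= k < 169) @chart_volume R M (center k) (B k)))//.
  rewrite big_mkord; apply: lte_sum_pinfty => k _.
  by rewrite /B ltn_ord chart_volume_cell ltry.
exists 169%N => // n /= n169.
rewrite (big_cat_nat _ n169)//= [X in _ + X]big1_seq ?adde0// => k.
rewrite mem_index_iota => /andP[_ /andP[k169 _]].
rewrite /B ltnNge k169 /= /chart_volume image_set0.
rewrite /= integral0_eq// => a _; rewrite integral0_eq// => b _.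
by rewrite integral0_eq// => t _; rewrite indic0 mul0r.
Qed.

End Volume.

(** * The diffeomorphism is Anosov *)

Section Anosov.
Context {R : realType}.
Local Notation V := 'rV[R]_3.
Local Notation G := (@torus_line R).
Local Notation M := (@torus_line_riemannian R).
Local Notation proj := (@proj R 3 G).

(** A fundamental unit of Z[sqrt 3] and its conjugate, which is its inverse. *)
Definition eig_u : R := 2 + sqrt3.
Definition eig_s : R := 2 - sqrt3.

Lemma eig_us : eig_u * eig_s = 1.
Proof. by rewrite /eig_u /eig_s mulrC -subr_sqr sqrt3_sqr; ring. Qed.

Lemma eig_s_bounds : 1 / 2 <= 2 * eig_s < 1 /\ 0 < eig_s.
Proof.
have := @sqrt3_gt R; have := @sqrt3_lt R; rewrite /eig_s => h1 h2.
by split; [apply/andP; split|]; lra.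
Qed.

Definition stretch (a b c : R) : 'M[R]_3 := diag_mx (vec3 a b c).

Lemma stretchE a b c (v : V) :
  v *m stretch a b c = vec3 (v 0 i0 * a) (v 0 i1 * b) (v 0 i2 * c).
Proof. by rewrite mul_mx_diag; apply: vec3P; rewrite !mxE. Qed.

Lemma stretch1 (v : V) : v *m stretch 1 1 1 = v.
Proof. by rewrite stretchE; apply: vec3P; rewrite vec3E mulr1. Qed.

Lemma stretchM a b c a' b' c' (v : V) :
  v *m stretch a b c *m stretch a' b' c' = v *m stretch (a * a') (b * b') (c * c').
Proof. by rewrite !stretchE !vec3E !mulrA. Qed.

Lemma lattice_stretch (c : R) (v : V) :
  lattice v -> lattice (v *m stretch eig_u eig_s c).
Proof.
move=> [v2 [m [n [v0 v1]]]]; rewrite stretchE; split; first by rewrite vec3E v2 mul0r.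
exists (2 * m + 3 * n), (m + 2 * n); rewrite !vec3E v0 v1 /eig_u /eig_s.
have s2 := @sqrt3_sqr R; rewrite !rmorphD !rmorphM /=.
have -> : 3%:~R = sqrt3 ^+ 2 :> R by rewrite s2.
by split; ring.
Qed.

Lemma lattice_unstretch (c : R) (v : V) :
  lattice v -> lattice (v *m stretch eig_s eig_u c).
Proof.
move=> [v2 [m [n [v0 v1]]]]; rewrite stretchE; split; first by rewrite vec3E v2 mul0r.
exists (2 * m - 3 * n), (2 * n - m); rewrite !vec3E v0 v1 /eig_u /eig_s.
have s2 := @sqrt3_sqr R; rewrite !rmorphB !rmorphM /=.
have -> : 3%:~R = sqrt3 ^+ 2 :> R by rewrite s2.
by split; ring.
Qed.

Definition expand : M -> M := @linear_map R 3 G isT (stretch eig_u eig_s 2).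
Definition contract : M -> M := @linear_map R 3 G isT (stretch eig_s eig_u 2^-1).

Lemma expand_proj p : expand (proj p) = proj (p *m stretch eig_u eig_s 2).
Proof. by apply: linear_map_proj; exact: lattice_stretch. Qed.

Lemma contract_proj p : contract (proj p) = proj (p *m stretch eig_s eig_u 2^-1).
Proof. by apply: linear_map_proj; exact: lattice_unstretch. Qed.

Lemma expandK : cancel expand contract.
Proof.
move=> x; rewrite -(liftK x) expand_proj contract_proj stretchM.
by rewrite [eig_s * _]mulrC eig_us divff// stretch1.
Qed.

Lemma contractK : cancel contract expand.
Proof.
move=> x; rewrite -(liftK x) contract_proj expand_proj stretchM.
by rewrite [eig_s * _]mulrC eig_us mulVf// stretch1.
Qed.

(** A hyperbolic automorphism of the torus times the doubling of the line. *)
Definition cat_map : C1_diffeo M :=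
  @C1Diffeo R M expand contract expandK contractK
    (@linear_map_C1 R 3 G isT _ (@lattice_stretch 2))
    (@linear_map_C1 R 3 G isT _ (@lattice_unstretch 2^-1)).

Lemma iter_linear_map (a b c : R) n :
  (forall v, lattice v -> lattice (v *m stretch a b c)) ->
  iter n (@linear_map R 3 G isT (stretch a b c)) =
    @linear_map R 3 G isT (stretch (a ^+ n) (b ^+ n) (c ^+ n)) /\
  forall v, lattice v -> lattice (v *m stretch (a ^+ n) (b ^+ n) (c ^+ n)).
Proof.
move=> GA; elim: n => [|n [IH GAn]].
  by split=> [|v]; [apply/funext => x; rewrite /linear_map stretch1 liftK|rewrite stretch1].
split=> [|v Gv]; last by rewrite !exprSr -stretchM; apply: GA; exact: GAn.
by apply/funext => x; rewrite iterS IH /= linear_map_proj// stretchM -!exprSr.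
Qed.

Lemma iter_expand n : iter n expand =
  @linear_map R 3 G isT (stretch (eig_u ^+ n) (eig_s ^+ n) (2 ^+ n)).
Proof. by have [] := iter_linear_map n (@lattice_stretch 2). Qed.

Lemma iter_contract n : iter n contract =
  @linear_map R 3 G isT (stretch (eig_s ^+ n) (eig_u ^+ n) (2^-1 ^+ n)).
Proof. by have [] := iter_linear_map n (@lattice_unstretch 2^-1). Qed.

Lemma iter_expand_proj n p : iter n expand (proj p) =
  proj (p *m stretch (eig_u ^+ n) (eig_s ^+ n) (2 ^+ n)).
Proof.
rewrite iter_expand; apply: linear_map_proj.
by have [] := iter_linear_map n (@lattice_stretch 2).
Qed.

Lemma iter_contract_proj n p : iter n contract (proj p) =
  proj (p *m stretch (eig_s ^+ n) (eig_u ^+ n) (2^-1 ^+ n)).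
Proof.
rewrite iter_contract; apply: linear_map_proj.
by have [] := iter_linear_map n (@lattice_unstretch 2^-1).
Qed.

(** ** Invariant bundles *)

Definition axis (k : 'I_3) : V := delta_mx 0 k.
Definition stable_space : {vspace V} := <[axis i1]>%VS.
Definition unstable_space : {vspace V} := (<[axis i0]> + <[axis i2]>)%VS.

Lemma mem_stable (v : V) :
  (v \in stable_space) = (v 0 i0 == 0) && (v 0 i2 == 0).
Proof.
apply/vlineP/andP => [[k ->]|[/eqP v0 /eqP v2]]; first by rewrite !mxE/= !mulr0.
by exists (v 0 i1); apply: vec3P; rewrite !mxE/= ?mulr1 ?mulr0.
Qed.

Lemma mem_unstable (v : V) : (v \in unstable_space) = (v 0 i1 == 0).
Proof.
apply/memv_addP/eqP => [[_ /vlineP[k ->] [_ /vlineP[l ->] ->]]|v1].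
  by rewrite !mxE /= !mulr0 addr0.
exists (v 0 i0 *: axis i0); first exact/memvZ/memv_line.
exists (v 0 i2 *: axis i2); first exact/memvZ/memv_line.
by apply: vec3P; rewrite !mxE/= ?mulr1 ?mulr0 ?addr0 ?add0r.
Qed.

Lemma stable_unstable_direct :
  (stable_space + unstable_space)%VS = fullv /\
  (stable_space :&: unstable_space)%VS = 0%VS.
Proof.
split.
  apply/vspaceP => v; rewrite memvf; apply/memv_addP.
  exists (v 0 i1 *: axis i1); first exact/memvZ/memv_line.
  exists (vec3 (v 0 i0) 0 (v 0 i2)); first by rewrite mem_unstable vec3E.
  by apply: vec3P; rewrite !mxE/= ?mulr1 ?mulr0 ?addr0 ?add0r.
apply/eqP; rewrite -subv0; apply/subvP => v.
rewrite memv_cap mem_stable mem_unstable memv0 => /andP[/andP[/eqP v0 /eqP v2] /eqP v1].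
by apply/eqP; apply: vec3P; rewrite ?v0 ?v1 ?v2 mxE.
Qed.

(** Coordinate changes are locally translations, so that a bundle with constant
    fibre has constant, hence continuous, local frames. *)
Lemma constant_subbundle (E : {vspace V}) :
  @continuous_subbundle R M (fun _ => E).
Proof.
move=> x0; exists (\dim E), (fun j _ => tnth (vbasis E) j).
near=> x; split => [|j].
  rewrite (_ : [seq _ | _ <- _] = vbasis E) ?vbasisP//; exact: map_tnth_enum.
rewrite /continuous_field_at.
have Hx := @chart_dom_near R 3 G isT _ _ (@chart_dom_lift R 3 G x).
have E1 : \forall y \near x, tnth (vbasis E) j =
    @tangent_coord R M (chart_at x) y (tnth (vbasis E) j).
  by apply: filterS Hx => y xy; rewrite (@tangent_coord_id R 3 G isT _ y xy).
have E2 : tnth (vbasis E) j @[y --> x] -->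
    @tangent_coord R M (chart_at x) x (tnth (vbasis E) j).
  by rewrite -(nbhs_singleton E1); apply: cvg_cst; exact: nbhs_filter.
exact: cvg_trans (near_eq_cvg E1) E2.
Unshelve. all: by end_near. Qed.

Lemma expand_invariant (E : {vspace V}) :
  (forall (v : V) a b c, v \in E -> v *m stretch a b c \in E) ->
  @invariant_bundle R M expand (fun _ => E).
Proof.
move=> HE x; rewrite (@linear_map_tangent R 3 G isT _ (@lattice_stretch 2)).
apply/seteqP; split => [_ [v vE <-]|w wE]; first exact: HE.
exists (w *m stretch eig_s eig_u 2^-1); first exact: HE.
by rewrite stretchM [eig_s * _]mulrC eig_us mulVf// stretch1.
Qed.

Lemma warp_le (s t : R) : `|s| <= `|t| -> warp t <= warp s.
Proof.
move=> st; rewrite lef_pV2 ?posrE ?warp_den_gt0// lerD2l.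
by rewrite -(real_normK (num_real s)) -(real_normK (num_real t)) lerXn2r ?nnegrE.
Qed.

Lemma warp_div (s c : R) : 1 <= c -> warp (s / c) <= c ^+ 2 * warp s.
Proof.
move=> c1; have c0 : 0 < c by apply: lt_le_trans c1.
rewrite /warp ler_pdivlMr ?warp_den_gt0// ler_pdivrMl ?warp_den_gt0//.
rewrite mulrDl mul1r expr_div_n divfK ?expf_neq0 ?gt_eqF// lerD2r.
by rewrite exprn_ege1.
Qed.

Lemma tnorm_le (x y : M) (v w : V) (K : R) : 0 <= K ->
  warp (height y) * (w 0 i0 ^+ 2 + w 0 i1 ^+ 2) + w 0 i2 ^+ 2 <=
    K ^+ 2 * (warp (height x) * (v 0 i0 ^+ 2 + v 0 i1 ^+ 2) + v 0 i2 ^+ 2) ->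
  tnorm y w <= K * tnorm x v.
Proof.
move=> K0 H; rewrite !tnormE -{1}(ger0_norm K0) -sqrtr_sqr -sqrtrM ?sqr_ge0//.
exact: ler_wsqrtr.
Qed.

Lemma stretch_sqr_le (W W' v a K : R) : 0 <= W' -> W' <= W -> 0 <= a -> a <= K ->
  W' * (v * a) ^+ 2 <= K ^+ 2 * (W * v ^+ 2).
Proof.
move=> W0 WW a0 aK.
rewrite (_ : W' * _ = (W' * a ^+ 2) * v ^+ 2); last ring.
rewrite [leRHS]mulrCA mulrA ler_wpM2r ?sqr_ge0//.
by apply: ler_pM; rewrite ?sqr_ge0// lerXn2r ?nnegrE// (le_trans a0).
Qed.

(** The contraction eig_s is reinforced by the shrinking of the torus as |t|
    doubles; the rate 2 * eig_s is the one available in the unstable case. *)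
Lemma stable_contraction (x : M) (v : V) n : v \in stable_space ->
  tnorm (iter n expand x) (v *m stretch (eig_u ^+ n) (eig_s ^+ n) (2 ^+ n)) <=
  (2 * eig_s) ^+ n * tnorm x v.
Proof.
rewrite mem_stable => /andP[/eqP v0 /eqP v2].
have [/andP[k0 k1] s0] := eig_s_bounds.
apply: tnorm_le; first by rewrite exprn_ge0// mulr_ge0// ltW.
rewrite stretchE !vec3E v0 v2 !mul0r expr0n /= !addr0 !add0r.
rewrite -[x](liftK x) iter_expand_proj !height_proj stretchE vec3E.
have w2 : warp (lift x 0 i2 * 2 ^+ n) <= warp (lift x 0 i2).
  by apply: warp_le; rewrite normrM ler_peMr// ger0_norm ?exprn_ge0// exprn_ege1// ler1n.
apply: stretch_sqr_le; rewrite ?(ltW (warp_gt0 _))//.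
- by rewrite exprn_ge0// ltW.
- by rewrite lerXn2r ?nnegrE ?mulr_ge0// ?(ltW s0)// ler_peMl ?(ltW s0)// ler1n.
Qed.

(** Backwards, the size of the torus grows by a factor at most 2, which leaves
    the rate 2 * eig_s < 1; the line contracts by 1 / 2 <= 2 * eig_s. *)
Lemma unstable_contraction (x : M) (v : V) n : v \in unstable_space ->
  tnorm (iter n contract x) (v *m stretch (eig_s ^+ n) (eig_u ^+ n) (2^-1 ^+ n)) <=
  (2 * eig_s) ^+ n * tnorm x v.
Proof.
rewrite mem_unstable => /eqP v1.
have [/andP[k0 k1] s0] := eig_s_bounds.
have k2 : 2^-1 <= 2 * eig_s by rewrite -div1r.
have K0 : 0 <= (2 * eig_s) ^+ n by rewrite exprn_ge0// mulr_ge0// ltW.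
apply: tnorm_le => //.
rewrite stretchE !vec3E v1 !mul0r expr0n /= !addr0.
rewrite -[x](liftK x) iter_contract_proj !height_proj stretchE vec3E mulrDr.
have w2 : warp (lift x 0 i2 * 2^-1 ^+ n) <= (2 ^+ n) ^+ 2 * warp (lift x 0 i2).
  by rewrite exprVn; apply: warp_div; rewrite exprn_ege1// ler1n.
apply: lerD.
  rewrite (_ : warp _ * _ = (warp (lift x 0 i2 * 2^-1 ^+ n) *
    (eig_s ^+ n) ^+ 2) * v 0 i0 ^+ 2); last ring.
  rewrite [leRHS]mulrA ler_wpM2r ?sqr_ge0//.
  apply: (le_trans (ler_wpM2r (sqr_ge0 _) w2)).
  by rewrite exprMn le_eqVlt; apply/orP; left; apply/eqP; ring.
rewrite exprMn mulrC ler_wpM2r ?sqr_ge0//.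
have h0 : 0 <= 2^-1 ^+ n :> R by rewrite exprn_ge0// invr_ge0.
apply: lerXn2r; rewrite ?nnegrE//; apply: lerXn2r; rewrite ?nnegrE ?invr_ge0//.
by rewrite mulr_ge0// ltW.
Qed.

Lemma op_norm_le (x y : M) (E : {vspace V}) (A : V -> V) (K : R) : 0 <= K ->
  (forall v, v \in E -> tnorm y (A v) <= K * tnorm x v) ->
  (@op_norm R M x y E A <= K%:E)%E.
Proof.
move=> K0 H; apply: ge_ereal_sup => _ [v [vE v1] <-].
rewrite lee_fin (le_trans (H v vE))//.
by rewrite -[leRHS]mulr1 ler_wpM2l.
Qed.

Lemma cat_map_anosov : anosov_splitting cat_map
  (fun _ => stable_space) (fun _ => unstable_space).
Proof.
have [k01 s0] := eig_s_bounds; have /andP[k0 k1] := k01.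
have [fullE capE] := stable_unstable_direct.
split.
- by move=> x; split => //; exact/directv_addP.
- by split; exact: constant_subbundle.
- split; apply: expand_invariant => v a b c.
    by rewrite !mem_stable stretchE !vec3E => /andP[/eqP -> /eqP ->]; rewrite !mul0r eqxx.
  by rewrite !mem_unstable stretchE !vec3E => /eqP ->; rewrite mul0r.
exists 1, (2 * eig_s); split => //; first by rewrite k1 mulr_gt0.
move=> x n; rewrite mul1r.
have K0 : 0 <= (2 * eig_s) ^+ n by rewrite exprn_ge0// mulr_ge0// ltW.
have [_ Gu] := iter_linear_map n (@lattice_stretch 2).
have [_ Gs] := iter_linear_map n (@lattice_unstretch 2^-1).
split; apply: op_norm_le => // v vE.
- rewrite [tangent_map _ _](_ : _ = fun v => v *m stretch (eig_u ^+ n) (eig_s ^+ n) (2 ^+ n)).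
    exact: stable_contraction.
  by rewrite [X in tangent_map X](iter_expand n) (@linear_map_tangent R 3 G isT _ Gu).
- rewrite [tangent_map _ _](_ : _ = fun v => v *m stretch (eig_s ^+ n) (eig_u ^+ n) (2^-1 ^+ n)).
    exact: unstable_contraction.
  by rewrite [X in tangent_map X](iter_contract n) (@linear_map_tangent R 3 G isT _ Gs).
Qed.

Lemma stable_unstable_orthogonal :
  @orthogonal_bundles R M (fun _ => stable_space) (fun _ => unstable_space).
Proof.
move=> x u v; rewrite mem_stable mem_unstable metricE => /andP[/eqP u0 /eqP u2] /eqP v1.
by rewrite u0 u2 v1; ring.
Qed.

End Anosov.

(** * Lipschitz shadowing *)

Section Recurrences.
Context {R : realType}.
Implicit Types (e v w : int -> R) (rho kappa : R).

(** The bounded solution of a contracting recurrence sums the past errors;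
    it converges when the weights grow slower backwards than the recurrence
    contracts. *)
Lemma contracting_recurrence rho kappa e w : 0 < rho -> 0 <= kappa ->
  kappa * rho < 1 -> (forall n, w (n - 1) <= kappa * w n) ->
  (forall n, `|e n| <= w n) ->
  exists v, forall n, v (n + 1) = rho * v n + e n /\
    `|v n| <= kappa / (1 - kappa * rho) * w n.
Proof.
move=> rho0 kappa0 kr1 wS ew.
have wk n k : w (n - k%:Z) <= kappa ^+ k * w n.
  elim: k => [|k IH]; first by rewrite subr0 mul1r.
  have -> : n - k.+1%:Z = n - k%:Z - 1 by lia.
  by rewrite (le_trans (wS _))// exprS -mulrA ler_wpM2l.
pose u n k := rho ^+ k * e (n - 1 - k%:Z).
have u_le n k : `|u n k| <= geometric (kappa * w n) (kappa * rho) k.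
  rewrite /u normrM (ger0_norm (exprn_ge0 _ (ltW rho0))) /geometric /=.
  have -> : kappa * w n * (kappa * rho) ^+ k = rho ^+ k * (kappa ^+ k.+1 * w n).
    by rewrite exprMn exprS; ring.
  rewrite ler_wpM2l ?exprn_ge0 ?(ltW rho0)// (le_trans (ew _))//.
  by have -> : n - 1 - k%:Z = n - k.+1%:Z by lia.
have kr : `|kappa * rho| < 1 by rewrite ger0_norm// mulr_ge0// ltW.
have cvg_abs n : cvgn (series (fun k => `|u n k|)).
  apply: (@series_le_cvg _ _ (geometric (kappa * w n) (kappa * rho))) => //.
  - by move=> k; exact: le_trans (u_le n k).
  - exact: is_cvg_geometric_series.
have cvg_u n : cvgn (series (u n)) := normed_cvg (cvg_abs n).
exists (fun n => limn (series (u n))) => n; split.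
  apply/cvg_lim => //; rewrite -cvg_shiftS /=.
  have -> : (fun k => series (u (n + 1)) k.+1) =
      (fun k => rho * series (u n) k + e n).
    apply/funext => k; rewrite /series /= big_nat_recl// addrC; congr (_ + _).
      rewrite mulr_sumr; apply: eq_bigr => j _; rewrite /u exprS -mulrA.
      by congr (_ * (_ * e _)); lia.
    by rewrite /u expr0 mul1r; congr e; lia.
  by apply: cvgD; [apply: cvgM; [exact: cvg_cst|exact: cvg_u]|exact: cvg_cst].
rewrite (le_trans (lim_series_norm (cvg_abs n)))//.
have cg := @cvg_geometric_series R (kappa * w n) (kappa * rho) kr.
rewrite [leRHS]mulrAC -(cvg_lim (@Rhausdorff R) cg).
exact: (lim_series_le (cvg_abs n) (cvgP _ cg) (u_le n)).
Qed.

(** An expanding recurrence is a contracting one when run backwards. *)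
Lemma expanding_recurrence rho kappa e w : 0 < rho -> 0 <= kappa ->
  kappa * rho < 1 -> (forall n, w (n + 1) <= kappa * w n) ->
  (forall n, w (n - 1) <= kappa * w n) ->
  (forall n, `|e n| <= w n) ->
  exists v, forall n, v (n + 1) = rho^-1 * v n + e n /\
    `|v n| <= kappa / (1 - kappa * rho) * w n.
Proof.
move=> rho0 kappa0 kr1 wS wP ew.
pose e' (n : int) := - (rho * e (- n - 1)).
pose w' (n : int) := rho * w (- n - 1).
have [| |v Hv] := @contracting_recurrence rho kappa e' w' rho0 kappa0 kr1.
- move=> n; rewrite /w' mulrCA ler_wpM2l ?(ltW rho0)//.
  have -> : - (n - 1) - 1 = (- n - 1) + 1 by lia.
  exact: wS.
- move=> n; rewrite /e' /w' normrN normrM (gtr0_norm rho0).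
  exact: (ler_wpM2l (ltW rho0)).

exists (fun n => v (- n)) => n; split.
  have [vE _] := Hv (- (n + 1)).
  have e1 : - (n + 1) + 1 = - n by lia.
  rewrite e1 /e' in vE.
  have e2 : - - (n + 1) - 1 = n by lia.
  rewrite e2 in vE.
  rewrite vE mulrDr mulKf ?gt_eqF// mulrN mulKf ?gt_eqF//; ring.
have [_ vn] := Hv (- n); rewrite (le_trans vn)//.
rewrite /w' opprK ler_wpM2l//.
  by rewrite divr_ge0// subr_ge0 ltW.
have w0 : 0 <= w n by exact: le_trans (ew n).
rewrite (le_trans (ler_wpM2l (ltW rho0) (wP n)))//.
by rewrite mulrA mulrC ler_piMr// mulrC ltW.
Qed.

End Recurrences.

Lemma iterz_orbit (T : Type) (f g : T -> T) (o : int -> T) : cancel f g ->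
  (forall n, f (o n) = o (n + 1)) -> forall n, iterz f g n (o 0) = o n.
Proof.
move=> fK of_ [n|n] /=.
  elim: n => [//|n IH]; rewrite iterS IH of_; congr o; lia.
elim: n => [|n IH].
  by rewrite /= -(fK (o (Negz 0))) of_; congr (g (o _)).
rewrite iterS IH -[RHS](fK (o (Negz n.+1))) of_; congr (g (o _)); lia.
Qed.

Section Shadowing.
Context {R : realType}.
Local Notation V := 'rV[R]_3.
Local Notation G := (@torus_line R).
Local Notation M := (@torus_line_riemannian R).
Local Notation proj := (@proj R 3 G).

(** Errors are corrected separately in the three eigendirections. Along the
    torus they are measured against the weight 1 + |t|, which at most doubles or
    halves at each step, while these directions expand or contract by a factor
    larger than 2. *)
Lemma cat_map_shadowing :
  lipschitz_shadowing (@rdist R M) cat_map (diffeo_inv cat_map).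
Proof.
have [/andP[k0 k1] s0] := @eig_s_bounds R.
pose K : R := 2 / (1 - 2 * eig_s).
have K0 : 0 < K by rewrite divr_gt0// subr_gt0.
exists (4 + 32 * K), (1 / 8); split; [lra|lra|].
move=> d /andP[d0 d1] x xd.
pose p n : V := lift (x n).
have px n : proj (p n) = x n by exact: liftK.
have /choice[q Hq] : forall n : int, exists q : V, [/\ proj q = x (n + 1),
    `|q 0 i2 - (p n *m stretch eig_u eig_s 2) 0 i2| <= 2 * d &
    forall k, k != i2 -> `|q 0 k - (p n *m stretch eig_u eig_s 2) 0 k| <=
      (1 + `|(p n *m stretch eig_u eig_s 2) 0 i2| + 2 * d) * (2 * d)].
  move=> n; apply: (@rdist_displacement R (cat_map (x n)) (x (n + 1)) d (2 * d)
    (p n *m stretch eig_u eig_s 2) (xd n)); first lra.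
  by rewrite -(px n) [RHS]expand_proj.
pose e n := q n - p n *m stretch eig_u eig_s 2.
have eE n k : e n 0 k = q n 0 k - (p n *m stretch eig_u eig_s 2) 0 k.
  by rewrite /e !mxE.
pose t n := p n 0 i2; pose w n := 1 + `|t n|.
have w1 n : 1 <= w n by rewrite lerDl.
have q2 n : q n 0 i2 = t (n + 1).
  by have [qx _ _] := Hq n; rewrite -height_proj qx -px height_proj.
have e2 n : `|t (n + 1) - 2 * t n| <= 2 * d.
  by have [_ + _] := Hq n; rewrite q2 stretchE vec3E [_ * 2]mulrC.
have wS n : w (n + 1) <= 2 * w n.
  have := ler_normD (t (n + 1) - 2 * t n) (2 * t n); rewrite subrK normrM ger0_norm//.
  by have := e2 n; rewrite /w; lra.
have wP n : w (n - 1) <= 2 * w n.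
  have := ler_normB (t (n - 1 + 1)) (t (n - 1 + 1) - 2 * t (n - 1)).
  rewrite opprB addrC subrK normrM ger0_norm//.
  by have := e2 (n - 1); rewrite subrK /w; have := normr_ge0 (t n); lra.
have ek n k : k != i2 -> `|e n 0 k| <= 4 * d * w n.
  move=> k2; have [_ _ /(_ k k2)] := Hq n; rewrite eE.
  move/le_trans; apply; rewrite stretchE vec3E normrM [`|2|]ger0_norm// -/(t n) /w.
  by have := normr_ge0 (t n); nra.
have e2' n : `|e n 0 i2| <= 2 * d.
  by rewrite eE q2 stretchE vec3E [_ * 2]mulrC e2.
have w4S n : 4 * d * w (n + 1) <= 2 * (4 * d * w n).
  by rewrite mulrCA ler_wpM2l// mulr_ge0// ltW.
have w4P n : 4 * d * w (n - 1) <= 2 * (4 * d * w n).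
  by rewrite mulrCA ler_wpM2l// mulr_ge0// ltW.
have [v0 Hv0] := @expanding_recurrence R eig_s 2 (fun n => e n 0 i0)
  (fun n => 4 * d * w n) s0 (ler0n _ 2) k1 w4S w4P (fun n => ek n i0 isT).
have [v1 Hv1] := @contracting_recurrence R eig_s 2 (fun n => e n 0 i1)
  (fun n => 4 * d * w n) s0 (ler0n _ 2) k1 w4P (fun n => ek n i1 isT).
have [||||v2 Hv2] := @expanding_recurrence R 2^-1 1 (fun n => e n 0 i2)
  (fun n => 2 * d) _ ler01 _ _ _ e2'; [lra|lra|by move=> _; rewrite mul1r..|].
  (* The corrections of the lifted pseudo-orbit to a lifted orbit. *)
pose v n : V := vec3 (v0 n) (v1 n) (v2 n).
have us : eig_s^-1 = eig_u :> R.
  by rewrite -[LHS]mul1r -eig_us mulfK// gt_eqF.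
have vS n : v (n + 1) = v n *m stretch eig_u eig_s 2 + e n.
  rewrite stretchE; apply: vec3P; rewrite [in RHS]mxE !vec3E.
  - by have [-> _] := Hv0 n; rewrite us mulrC.
  - by have [-> _] := Hv1 n; rewrite mulrC.
  - by have [-> _] := Hv2 n; rewrite invrK mulrC.
pose o n : M := proj (p n - v n).
have oS n : cat_map (o n) = o (n + 1).
  rewrite /o [LHS]expand_proj; apply/projP.
  have /projP : proj (q n) = proj (p (n + 1)) by have [-> _ _] := Hq n; rewrite px.
  congr (G _); rewrite vS /e mulmxBl opprB; apply/rowP => k; rewrite !mxE; ring.
exists (o 0) => n.
rewrite (iterz_orbit (@expandK R) oS) -px /o.
rewrite -[p n in X in rdist _ X](subrK (v n)).
apply: (le_trans (rdist_le _ _)); rewrite lee_fin.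
have [_ b0] := Hv0 n; have [_ b1] := Hv1 n; have [_ b2] := Hv2 n.
rewrite !vec3E !mxE /= -/(t n).
have {}b2 : `|v2 n| <= 4 * d.
  have c2 : 1 / (1 - 1 * 2^-1) = 2 :> R by field.
  by move: b2; rewrite c2; lra.
  (* The correction in height is less than 1/2, so that the weight at the
     corrected point is at least half the weight at the pseudo-orbit. *)
have W : w n / 2 <= 1 + `|t n - v2 n|.
  have := ler_normD (t n - v2 n) (v2 n); rewrite subrK /w.
  have := normr_ge0 (t n); lra.
have W0 : 0 < 1 + `|t n - v2 n| by rewrite ltr_wpDr.
rewrite [leRHS]mulrDl; apply: lerD => //.
rewrite ler_pdivrMr//.
rewrite -/K in b0 b1.
have Kd : 0 <= 32 * K * d.
  by apply: mulr_ge0; [apply: mulr_ge0 => //; exact: ltW|exact: ltW].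
apply: (le_trans _ (ler_wpM2l Kd W)).
have -> : 32 * K * d * (w n / 2) = 2 * (K * (4 * d * w n) + K * (4 * d * w n)) by field.
by rewrite ler_wpM2l// lerD.
Qed.

End Shadowing.

(** * Failure of expansiveness *)

Section NotExpansive.
Context {R : realType}.
Local Notation V := 'rV[R]_3.
Local Notation G := (@torus_line R).
Local Notation M := (@torus_line_riemannian R).
Local Notation proj := (@proj R 3 G).

Lemma rdist_torus_le (a b c : R) :
  (rdist (proj (vec3 0 0 c) : M) (proj (vec3 a b c) : M) <=
     (2 * (`|a| + `|b|) / (1 + `|c|))%:E)%E.
Proof.
have -> : vec3 a b c = vec3 0 0 c + vec3 a b 0.
  by apply: vec3P; rewrite !mxE /= ?add0r ?addr0.
by apply: (le_trans (rdist_le _ _)); rewrite !vec3E normr0 add0r.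
Qed.

(** The two points differ by s along the unstable direction of the torus at
    height T. In the past this difference decreases; in the future their torus
    has diameter at most 12 / T = eps, whatever their position on it. *)
Lemma cat_map_not_expansive :
  ~ expansive (@rdist R M) cat_map (diffeo_inv cat_map).
Proof.
move=> [eps eps0 H].
have [/andP[k0 k1] s0] := @eig_s_bounds R.
pose s := eps / 2; pose T := 12 / eps.
have T0 : 0 < T by rewrite divr_gt0.
have s1 : 0 < s by rewrite divr_gt0.
suff : proj (vec3 0 0 T) = proj (vec3 s 0 T).
  move=> /projP /lattice_norm; rewrite !mxE /=.
  rewrite subrr mulr0 normr0 ltr01 => /(_ isT) /(congr1 (fun v : V => v 0 i0)).
  rewrite !mxE /= sub0r => /eqP; rewrite oppr_eq0 => /eqP s00.
  by move: s1; rewrite s00 ltxx.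
apply: H => -[n|n].
- rewrite /= !iter_expand_proj !stretchE !vec3E !mul0r.
  have [v Gv [v2 [v0 v1]]] := lattice_reduce (s * eig_u ^+ n) 0.
  rewrite -(proj_translate (G := G) (vec3 (s * eig_u ^+ n) 0 _) Gv).
  have -> : vec3 (s * eig_u ^+ n) 0 (T * 2 ^+ n) + v =
      vec3 (s * eig_u ^+ n + v 0 i0) (0 + v 0 i1) (T * 2 ^+ n).
    by apply: vec3P; rewrite mxE !vec3E// v2 addr0.
  apply: (le_trans (rdist_torus_le _ _ _)); rewrite lee_fin.
  have T2 : T <= `|T * 2 ^+ n|.
    apply: le_trans (ler_norm _).
    by rewrite ler_peMr ?(ltW T0)// exprn_ege1// ler1n.
  rewrite ler_pdivrMr ?ltr_wpDr//.
  have epsT : eps * T = 12 by rewrite /T; field; rewrite gt_eqF.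
  have := ler_wpM2l (ltW eps0) T2; lra.
- rewrite [iterz _ _ _]/= !iter_contract_proj !stretchE !vec3E !mul0r.
  apply: (le_trans (rdist_torus_le _ _ _)); rewrite lee_fin normr0 addr0.
  rewrite ler_pdivrMr ?ltr_wpDr//.
  have sn : `|s * eig_s ^+ n.+1| <= s.
    have e0 : 0 <= eig_s ^+ n.+1 :> R by rewrite exprn_ge0// ltW.
    rewrite ger0_norm; last by rewrite mulr_ge0// ltW.
    by rewrite ler_piMr ?(ltW s1)//; apply: exprn_ile1; lra.
  have es : eps = 2 * s by rewrite /s; field.
  rewrite es; have := normr_ge0 (T * 2^-1 ^+ n.+1); nra.
Qed.

End NotExpansive.

Theorem theorem4 (R : realType) :
  exists (M : riemannian_manifold R) (F : C1_diffeo M),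
    [/\ connected_manifold M, complete_manifold M, finite_volume M & bounded_sec M] /\
    [/\ (exists Es Eu : M -> {vspace 'rV[R]_(mdim M)},
           anosov_splitting F Es Eu /\ orthogonal_bundles Es Eu),
        lipschitz_shadowing (@rdist R M) F (diffeo_inv F) &
        ~ expansive (@rdist R M) F (diffeo_inv F)].
Proof.
exists torus_line_riemannian, cat_map; split; split.
- exact: torus_line_connected.
- exact: torus_line_complete.
- exact: torus_line_finite_volume.
- exact: torus_line_bounded_sec.
- exists (fun _ => stable_space), (fun _ => unstable_space); split.
    exact: cat_map_anosov.
  exact: stable_unstable_orthogonal.
- exact: cat_map_shadowing.
- exact: cat_map_not_expansive.
Qed.
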